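(* Let $k=k_0(T)$ be a rational function field over a finite field $k_0$ of characteristic $p$ with $\mathbb{F}_q\subseteq k_0$, $q=p^n$, and let $m\in\mathbb{N}$. Let $K/k$ be an extension with $\operatorname{Gal}(K/k)\cong W_m(\mathbb{F}_q)$ and such that $P_1,\ldots,P_r\in k_0[T]$ (monic irreducible polynomials), and possibly $\mathcal{P}_\infty$, are the ramified primes. Then $K=k(\vec y)$ is given by $$\vec y^{\,q}-\vec y=\vec\beta=\vec\delta_1+\cdots+\vec\delta_r+\vec\gamma,$$ with $y_1^q-y_1=\beta_1$ irreducible (i.e. $X^q-X-\beta_1\in k[X]$ is irreducible), where $\vec\delta_i=(\delta_{i1},\ldots,\delta_{im})$, $\delta_{ij}=\frac{Q_{ij}}{P_i^{e_{ij}}}$, $e_{ij}\geq 0$, $Q_{ij}\in k_0[T]$, and if $e_{ij}>0$, then $e_{ij}=\lambda_{ij}p^{m_{ij}}$ with $\gcd(\lambda_{ij},p)=1$, $0\leq m_{ij}<n$, $\gcd(Q_{ij},P_i)=1$ and $\deg(Q_{ij})<\deg(P_i^{e_{ij}})$; and $\vec\gamma=(\gamma_1,\ldots,\gamma_m)$ with $\gamma_j=f_j(T)\in k_0[T]$, where $\deg f_j=\nu_jp^{m_j}$ with $\gcd(q,\nu_j)=1$ and $0\leq m_j<n$ when $f_j\notin k_0$.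
   Context: $W_m(R)$ denotes the ring of $p$-typical Witt vectors of length $m$ over a commutative ring $R$; $+$, $-$ between Witt vectors denote the Witt operations. For $\vec x=(x_1,\ldots,x_m)$, $\vec x^{\,q}:=(x_1^q,\ldots,x_m^q)$ (componentwise power). $k(\vec y)=k(y_1,\ldots,y_m)$ for $\vec y=(y_1,\ldots,y_m)$. $\mathcal{P}_\infty$ is the infinite prime of $k$, the pole of $T$. $W_m(\mathbb{F}_q)\cong(\mathbb{Z}/p^m\mathbb{Z})^n$ as an additive group. *)

(* Defs.v *)
From HB Require Import structures.
From mathcomp Require Import all_boot all_order all_algebra.
From mathcomp Require Import all_fingroup all_solvable all_field.
From mathcomp Require Import mpoly.

Set Implicit Arguments.
Unset Strict Implicit.
Unset Printing Implicit Defensive.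

Import Order.TTheory GRing.Theory Num.Theory.
Local Open Scope ring_scope.

(** Witt vectors of length m are m-tuples.  The ring operations are given by
    the universal integral polynomials determined by the ghost components
    x |-> sum_(i <= n) p^i x_i^(p^(n - i)), indexed from 0. *)

Definition ghost (p : nat) (R : comNzRingType) (x : seq R) (n : nat) : R :=
  \sum_(i < n.+1) x`_i ^+ (p ^ (n - i)) *+ p ^ i.

(* Coefficientwise Euclidean quotient; below it is only used for exact
   divisions (see [unghostP]). *)
Definition mpoly_divn (N : nat) (d : nat) (f : {mpoly int[N]}) :
    {mpoly int[N]} :=
  \sum_(mu <- msupp f) (f@_mu %/ d)%Z *: 'X_[mu].

(* The first m entries of the vector whose ghost components are the g n. *)
Fixpoint unghost (p N : nat) (g : nat -> {mpoly int[N]}) (m : nat) :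
    seq {mpoly int[N]} :=
  if m is n.+1 then
    let s := unghost p g n in
    rcons s (mpoly_divn (p ^ n)
               (g n - \sum_(i < n) s`_i ^+ (p ^ (n - i)) *+ p ^ i))
  else [::].

Definition mpoly_vars (N : nat) : N.-tuple {mpoly int[N]} :=
  [tuple 'X_i | i < N].

Definition ghostX (p m : nat) : nat -> {mpoly int[m + m]} :=
  ghost p (take m (mpoly_vars (m + m))).
Definition ghostY (p m : nat) : nat -> {mpoly int[m + m]} :=
  ghost p (drop m (mpoly_vars (m + m))).

Definition witt_add_poly (p m : nat) : seq {mpoly int[m + m]} :=
  unghost p (fun n => ghostX p m n + ghostY p m n) m.
Definition witt_mul_poly (p m : nat) : seq {mpoly int[m + m]} :=
  unghost p (fun n => ghostX p m n * ghostY p m n) m.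
Definition witt_opp_poly (p m : nat) : seq {mpoly int[m]} :=
  unghost p (fun n => - ghost p (mpoly_vars m) n) m.

Definition mpoly_at (N : nat) (R : comNzRingType) (x : N.-tuple R) :
    {mpoly int[N]} -> R :=
  mmap (intr : int -> R) (tnth x).

(* Locked so that unification never unfolds the universal polynomials. *)
HB.lock Definition witt_add (p m : nat) (R : comNzRingType) (x y : m.-tuple R)
    : m.-tuple R :=
  [tuple mpoly_at (cat_tuple x y) (witt_add_poly p m)`_i | i < m].
HB.lock Definition witt_mul (p m : nat) (R : comNzRingType) (x y : m.-tuple R)
    : m.-tuple R :=
  [tuple mpoly_at (cat_tuple x y) (witt_mul_poly p m)`_i | i < m].
HB.lock Definition witt_opp (p m : nat) (R : comNzRingType) (x : m.-tuple R)
    : m.-tuple R :=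
  [tuple mpoly_at x (witt_opp_poly p m)`_i | i < m].
Definition witt_zero (m : nat) (R : comNzRingType) : m.-tuple R :=
  [tuple 0 | i < m].
Definition witt_one (m : nat) (R : comNzRingType) : m.-tuple R :=
  [tuple (nat_of_ord i == 0%N)%:R | i < m].

Section DivN.
Variable R : comNzRingType.
Implicit Types a b c : R.

Definition dvn (d : nat) a := exists c, a = c *+ d.

Lemma dvnD d a b : dvn d a -> dvn d b -> dvn d (a + b).
Proof. by move=> [u ->] [v ->]; exists (u + v); rewrite mulrnDl. Qed.
Lemma dvnN d a : dvn d a -> dvn d (- a).
Proof. by move=> [u ->]; exists (- u); rewrite mulNrn. Qed.
Lemma dvnB d a b : dvn d a -> dvn d b -> dvn d (a - b).
Proof. by move=> da /dvnN; apply: dvnD. Qed.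
Lemma dvn0 d : dvn d 0.
Proof. by exists 0; rewrite mul0rn. Qed.
Lemma dvnMl d a b : dvn d a -> dvn d (b * a).
Proof. by move=> [u ->]; exists (b * u); rewrite mulrnAr. Qed.
Lemma dvnMr d a b : dvn d a -> dvn d (a * b).
Proof. by rewrite mulrC; apply: dvnMl. Qed.
Lemma dvnMM d e a b : dvn d a -> dvn e b -> dvn (d * e) (a * b).
Proof.
by move=> [u ->] [v ->]; exists (u * v); rewrite mulrnAr mulrnAl -mulrnA.
Qed.
Lemma dvnMn d e a : dvn d a -> dvn (d * e) (a *+ e).
Proof. by move=> [u ->]; exists u; rewrite mulrnA. Qed.
Lemma dvn_trans d e a : (d %| e)%N -> dvn e a -> dvn d a.
Proof. by move=> /dvdnP[k ->] [u ->]; exists (u *+ k); rewrite mulrnA. Qed.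
Lemma dvn_sum d I (r : seq I) (P : pred I) (F : I -> R) :
  (forall i, P i -> dvn d (F i)) -> dvn d (\sum_(i <- r | P i) F i).
Proof. by move=> dF; apply: big_ind => //; [exact: dvn0|exact: dvnD]. Qed.

Lemma dvn_exp1 d a b k : dvn d (a - b) -> dvn d (a ^+ k - b ^+ k).
Proof. by rewrite subrXX => /dvnMr; apply. Qed.

Lemma dvn_expp p k a b :
  dvn (p ^ k.+1) (a - b) -> dvn (p ^ k.+2) (a ^+ p - b ^+ p).
Proof.
move=> dab; rewrite subrXX [(p ^ k.+2)%N]expnSr; apply: dvnMM => //.
have {dab}: dvn p (a - b) by apply: dvn_trans dab; rewrite expnS dvdn_mulr.
move=> dab; suff: dvn p (\sum_(i < p) (a ^+ (p.-1 - i) * b ^+ i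
                                       - b ^+ (p.-1 - i) * b ^+ i)).
  rewrite sumrB => /dvnD H.
  have /H : dvn p (\sum_(i < p) b ^+ (p.-1 - i) * b ^+ i).
    rewrite (eq_bigr (fun=> b ^+ p.-1)) => [|i _].
      by rewrite sumr_const card_ord; exists (b ^+ p.-1).
    rewrite -exprD subnK // -ltnS prednK ?ltn_ord //.
    by apply: leq_ltn_trans (ltn_ord i).
  by rewrite subrK.
by apply: dvn_sum => i _; rewrite -mulrBl; apply/dvnMr/dvn_exp1.
Qed.

Lemma dvn_exppk p k j a b :
  dvn (p ^ k.+1) (a - b) -> dvn (p ^ (j + k).+1) (a ^+ (p ^ j) - b ^+ (p ^ j)).
Proof.
by move=> dab; elim: j => // j IH; rewrite [(p ^ j.+1)%N]expnSr !exprM; apply: dvn_expp.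
Qed.

End DivN.

Lemma dvn_expDp (R : comNzRingType) p (a b : R) :
  prime p -> dvn p ((a + b) ^+ p - (a ^+ p + b ^+ p)).
Proof.
move=> pr_p; have p_gt0 := prime_gt0 pr_p; rewrite exprDn.
rewrite -(prednK p_gt0) big_ord_recl big_ord_recr /= prednK //.
rewrite /bump /= !add1n prednK // subnn bin0 binn subn0 !expr0 mulr1 mul1r !mulr1n.
rewrite opprD addrACA subrr add0r addrK.
apply: dvn_sum => i _; rewrite /bump /= add1n.
have /dvdnP[c ->]: (p %| 'C(p, i.+1))%N.
  by apply: prime_dvd_bin => //=; rewrite -[X in (_ < X)%N](prednK p_gt0) ltnS.
by exists ((a ^+ (p - i.+1) * b ^+ i.+1) *+ c); rewrite mulrnA.
Qed.

Lemma mpoly_divnP N d (f g : {mpoly int[N]}) :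
  (0 < d)%N -> f = g *+ d -> mpoly_divn d f *+ d = f.
Proof.
move=> d_gt0 def_f; rewrite {2}[f]mpolyE /mpoly_divn -sumrMnl.
apply: eq_bigr => mu _; rewrite scalerMnl; congr (_ *: _).
rewrite -mulr_natr natz divzK // def_f mcoeffMn -mulr_natr natz.
exact: dvdz_mull.
Qed.

Section FrobeniusLift.
Variables (p N : nat) (pr_p : prime p).
Local Notation A := {mpoly int[N]}.

Definition frob_lift : A -> A :=
  mmap (@mpolyC N int) (fun i => 'X_i ^+ p).
HB.instance Definition _ := GRing.RMorphism.copy frob_lift
  (mmap (@mpolyC N int) (fun i => 'X_i ^+ p)).

Lemma dvn_int_fermat (c : int) : dvn p (c - c ^+ p).
Proof.
suff /dvdzP[u ->]: (p %| c - c ^+ p)%Z by exists u; rewrite -mulr_natr natz.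
rewrite (dvdz_pcharf (pchar_Fp pr_p)) rmorphB rmorphXn /=.
have := expf_card (c%:~R : 'F_p); rewrite card_Fp // => ->.
by rewrite subrr.
Qed.

Lemma frob_liftP (f : A) : dvn p (frob_lift f - f ^+ p).
Proof.
elim/mpolyind: f => [|c mu f _ _ IHf].
  by rewrite rmorph0 expr0n gtn_eqF ?prime_gt0 // subrr; apply: dvn0.
rewrite rmorphD /=; set t := c *: _; have Dt: dvn p (frob_lift t - t ^+ p).
  have ->: frob_lift t = c%:MP * 'X_[mu] ^+ p.
    rewrite /t /frob_lift mmapZ mmapX /mmap1 mpolyXE_id -prodrXl.
    by congr (_ * _); apply: eq_bigr => i _; rewrite -!exprM mulnC.
  rewrite /t -mul_mpolyC exprMn_comm; last exact: mulrC.
  rewrite -mulrBl; apply: dvnMr.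
  have [u Du] := dvn_int_fermat c; exists u%:MP.
  by rewrite -rmorphXn -rmorphB /= Du rmorphMn.
have /dvnD/(_ (dvnD Dt IHf)) := dvnN (dvn_expDp t f pr_p).
suff E (a b d u v : A) : - (a - (b + d)) + (u - b + (v - d)) = u + v - a.
  by rewrite E.
by rewrite opprB [u - b + _]addrACA -opprD [LHS]addrC addrA subrK.
Qed.

Definition dwork (g : nat -> A) : Prop :=
  forall n, dvn (p ^ n.+1) (g n.+1 - frob_lift (g n)).

Lemma size_unghost g m : size (unghost p g m : seq A) = m.
Proof. by elim: m => //= m IH; rewrite size_rcons IH. Qed.

Lemma nth_unghost (g : nat -> A) m i :
  (i < m)%N -> (unghost p g m)`_i = (unghost p g i.+1)`_i.
Proof.
elim: m => // m IH; rewrite ltnS leq_eqVlt => /predU1P[-> //|lt_im].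
by rewrite [unghost p g m.+1]/= nth_rcons size_unghost lt_im IH.
Qed.

Lemma ghost_ext (R : comNzRingType) (x y : seq R) n :
  (forall i, (i <= n)%N -> x`_i = y`_i) -> ghost p x n = ghost p y n.
Proof.
by move=> exy; apply: eq_bigr => i _; rewrite exy // -ltnS.
Qed.

Lemma unghostP (g : nat -> A) m n :
  dwork g -> (n < m)%N -> ghost p (unghost p g m) n = g n.
Proof.
move=> dg lt_nm.
have /ghost_ext->: forall i, (i <= n)%N ->
    (unghost p g m)`_i = (unghost p g n.+1)`_i.
  move=> i le_in; rewrite nth_unghost; last exact: leq_ltn_trans lt_nm.
  by rewrite [RHS]nth_unghost.
elim: n {m lt_nm} => [|n IHn].
  rewrite /ghost big_ord1 /= expr1 mulr1n big_ord0 subr0.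
  by have := @mpoly_divnP _ 1 (g 0%N) (g 0%N); rewrite !mulr1n; apply.
set s := unghost p g n.+1 in IHn.
rewrite /ghost big_ord_recr /=.
rewrite -/(unghost p g n.+1) -/s nth_rcons size_unghost ltnn eqxx.
rewrite subnn expr1 (eq_bigr (fun i : 'I_n.+1 =>
   s`_i ^+ (p ^ (n.+1 - i)) *+ p ^ i)) => [|i _]; last first.
  by rewrite nth_rcons size_unghost ltn_ord.
set S := \sum_(i < n.+1) _.
have: dvn (p ^ n.+1) (g n.+1 - S).
  suff E : dvn (p ^ n.+1) (frob_lift (g n) - S).
    by have := dvnD (dg n) E; rewrite addrA subrK.
  rewrite -IHn /ghost rmorph_sum.
  rewrite -sumrB; apply: dvn_sum => -[i /= lt_in] _.
  rewrite rmorphMn rmorphXn -mulrnBl subSn // [(p ^ (n - i).+1)%N]expnS exprM.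
  have ->: (p ^ n.+1 = p ^ (n - i).+1 * p ^ i)%N by rewrite -expnD addSn subnK.
  apply: dvnMn.
  have := @dvn_exppk _ p 0 (n - i) (frob_lift s`_i) (s`_i ^+ p).
  by rewrite addn0 expn1; apply; apply: frob_liftP.
case=> u Du; rewrite (mpoly_divnP _ Du) ?expn_gt0 ?prime_gt0 //.
by rewrite addrC subrK.
Qed.

Lemma dworkD g h : dwork g -> dwork h -> dwork (fun n => g n + h n).
Proof.
move=> dg dh n; rewrite rmorphD opprD addrACA; exact: dvnD.
Qed.

Lemma dworkN g : dwork g -> dwork (fun n => - g n).
Proof. by move=> dg n; rewrite rmorphN -opprD; apply: dvnN. Qed.

Lemma dworkM g h : dwork g -> dwork h -> dwork (fun n => g n * h n).
Proof.
move=> dg dh n; rewrite rmorphM -[g n.+1](subrK (frob_lift (g n))) mulrDl.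
rewrite -addrA -mulrBr; apply: dvnD; first exact: dvnMr.
exact: dvnMl.
Qed.

Lemma dwork_ghost (x : seq A) :
  (forall i, frob_lift x`_i = x`_i ^+ p) -> dwork (ghost p x).
Proof.
move=> frx n; rewrite /ghost big_ord_recr /= rmorph_sum subnn expn0 expr1.
rewrite addrAC -sumrB big1 => [|[i /= lt_in] _].
  by rewrite add0r; exists x`_n.+1.
by rewrite rmorphMn rmorphXn -[X in _ - X *+ _]/(frob_lift x`_i ^+ _) frx
  -exprM -expnS -subSn // subrr.
Qed.

Lemma frob_lift_vars i : (i < N)%N ->
  frob_lift (mpoly_vars N)`_i = (mpoly_vars N)`_i ^+ p.
Proof.
move=> lt_iN; have ->: i = Ordinal lt_iN by [].
by rewrite -tnth_nth tnth_mktuple /frob_lift mmapX mmap1U.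
Qed.

Lemma dwork_vars (x : seq A) :
  {subset x <= mpoly_vars N} -> dwork (ghost p x).
Proof.
move=> sx; apply: dwork_ghost => i.
have [lt_ix | le_xi] := ltnP i (size x).
  have /(nthP 0)[j] := sx _ (mem_nth 0 lt_ix).
  by rewrite size_tuple => ltj <-; apply: frob_lift_vars.
by rewrite nth_default // rmorph0 expr0n gtn_eqF ?prime_gt0.
Qed.

End FrobeniusLift.

Section WittTheory.
Variables (p : nat) (pr_p : prime p) (m : nat).

HB.instance Definition _ N (R : comNzRingType) (x : N.-tuple R) :=
  GRing.RMorphism.copy (mpoly_at x) (mmap (intr : int -> R) (tnth x)).

Lemma mpoly_atX N (R : comNzRingType) (x : N.-tuple R) i :
  mpoly_at x 'X_i = tnth x i.
Proof. by rewrite /mpoly_at mmapX mmap1U. Qed.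

Lemma mpoly_at_map N (R S : comNzRingType) (f : {rmorphism R -> S})
    (x : N.-tuple R) P :
  f (mpoly_at x P) = mpoly_at (map_tuple f x) P.
Proof.
rewrite /mpoly_at /mmap rmorph_sum; apply: eq_bigr => mu _.
rewrite rmorphM rmorph_int rmorph_prod; congr (_ * _); apply: eq_bigr => i _.
by rewrite rmorphXn tnth_map.
Qed.

Lemma nth_map0 (R S : comNzRingType) (f : {rmorphism R -> S}) (x : seq R) i :
  (map f x)`_i = f x`_i.
Proof.
have [lt_ix | le_xi] := ltnP i (size x); first exact: nth_map.
by rewrite !nth_default ?size_map // rmorph0.
Qed.

Lemma ghost_map (R S : comNzRingType) (f : {rmorphism R -> S}) (x : seq R) n :
  ghost p (map f x) n = f (ghost p x n).
Proof.
rewrite /ghost rmorph_sum; apply: eq_bigr => i _.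
by rewrite nth_map0 rmorphMn rmorphXn.
Qed.

Lemma mktuple_nth (T S : nmodType) (F : T -> S) (s : seq T) :
  size s = m -> [tuple F s`_i | i < m] = map F s :> seq S.
Proof.
move=> sz; apply: (@eq_from_nth _ 0); first by rewrite size_tuple size_map.
move=> i; rewrite size_tuple => lt_im; rewrite (nth_map 0) ?sz //.
by rewrite -[i]/(nat_of_ord (Ordinal lt_im)) -tnth_nth tnth_mktuple.
Qed.

Lemma map_vars N (R : comNzRingType) (x : N.-tuple R) :
  map (mpoly_at x) (mpoly_vars N) = x.
Proof.
suff: map_tuple (mpoly_at x) (mpoly_vars N) = x by move/(congr1 val).
by apply: eq_from_tnth => i; rewrite tnth_map tnth_mktuple mpoly_atX.
Qed.

Section Ghost.
Variable R : comNzRingType.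
Implicit Types x y z : m.-tuple R.

Lemma ghostXP x y n : mpoly_at (cat_tuple x y) (ghostX p m n) = ghost p x n.
Proof.
by rewrite -ghost_map map_take map_vars /= take_size_cat ?size_tuple.
Qed.

Lemma ghostYP x y n : mpoly_at (cat_tuple x y) (ghostY p m n) = ghost p y n.
Proof.
by rewrite -ghost_map map_drop map_vars /= drop_size_cat ?size_tuple.
Qed.

Lemma dwork_ghostX : dwork p (ghostX p m).
Proof. by apply: dwork_vars => // a; apply: mem_take. Qed.

Lemma dwork_ghostY : dwork p (ghostY p m).
Proof. by apply: dwork_vars => // a; apply: mem_drop. Qed.

Lemma ghost_witt_add x y n : (n < m)%N ->
  ghost p (witt_add p x y) n = ghost p x n + ghost p y n.
Proof.
move=> lt_nm; rewrite witt_add.unlock mktuple_nth ?size_unghost // ghost_map unghostP //.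
  by rewrite -(ghostXP x y) -(ghostYP x y); apply: rmorphD.
by apply: dworkD; [apply: dwork_ghostX|apply: dwork_ghostY].
Qed.

Lemma ghost_witt_mul x y n : (n < m)%N ->
  ghost p (witt_mul p x y) n = ghost p x n * ghost p y n.
Proof.
move=> lt_nm; rewrite witt_mul.unlock mktuple_nth ?size_unghost // ghost_map unghostP //.
  by rewrite -(ghostXP x y) -(ghostYP x y); apply: rmorphM.
by apply: dworkM; [apply: dwork_ghostX|apply: dwork_ghostY].
Qed.

Lemma ghost_witt_opp x n : (n < m)%N ->
  ghost p (witt_opp p x) n = - ghost p x n.
Proof.
move=> lt_nm; rewrite witt_opp.unlock mktuple_nth ?size_unghost // ghost_map unghostP //.
  by rewrite rmorphN -ghost_map map_vars.
by apply: dworkN; apply: dwork_vars.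
Qed.

Lemma nth_tuple_ord x i (lt_im : (i < m)%N) : x`_i = tnth x (Ordinal lt_im).
Proof. by rewrite (tnth_nth 0). Qed.

Lemma nth_witt_zero i : (witt_zero m R)`_i = 0.
Proof.
have [lt_im | le_mi] := ltnP i m; last by rewrite nth_default ?size_tuple.
by rewrite nth_tuple_ord tnth_mktuple.
Qed.

Lemma nth_witt_one i : (i < m)%N -> (witt_one m R)`_i = (i == 0%N)%:R.
Proof. by move=> lt_im; rewrite nth_tuple_ord tnth_mktuple. Qed.

Lemma ghost_witt_zero n : ghost p (witt_zero m R) n = 0.
Proof.
rewrite /ghost big1 // => i _; rewrite nth_witt_zero expr0n.
by rewrite expn_eq0 (gtn_eqF (prime_gt0 pr_p)) mul0rn.
Qed.

Lemma ghost_witt_one n : (n < m)%N -> ghost p (witt_one m R) n = 1.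
Proof.
move=> lt_nm; rewrite /ghost big_ord_recl big1 => [|i _].
  by rewrite nth_witt_one ?(leq_ltn_trans _ lt_nm) // expr1n addr0.
have le_in : (lift ord0 i <= n)%N by rewrite /= /bump add1n.
rewrite nth_witt_one ?(leq_ltn_trans le_in) // expr0n.
by rewrite expn_eq0 (gtn_eqF (prime_gt0 pr_p)) mul0rn.
Qed.

Lemma ghost_inj x y : (forall a : R, a *+ p = 0 -> a = 0) ->
  (forall n, (n < m)%N -> ghost p x n = ghost p y n) -> x = y.
Proof.
move=> tfR exy; apply: val_inj; apply: (@eq_from_nth _ 0).
  by rewrite !size_tuple.
move=> n; rewrite size_tuple; elim/ltn_ind: n => n IHn lt_nm.
have := exy n lt_nm; rewrite /ghost !big_ord_recr /= subnn !expr1.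
rewrite (eq_bigr (fun i : 'I_n => y`_i ^+ (p ^ (n - i)) *+ p ^ i)); last first.
  by case=> i /= lt_in _; rewrite IHn // (ltn_trans lt_in).
move/addrI/eqP; rewrite -subr_eq0 -mulrnBl => /eqP E.
apply/eqP; rewrite -subr_eq0; apply/eqP; move: E; move: (_ - _) => a.
elim: n {IHn lt_nm} a => [|n IH] a; first by rewrite expn0 mulr1n.
by rewrite expnSr mulrnA => /tfR; apply: IH.
Qed.

End Ghost.

Section Naturality.
Variables (R S : comNzRingType) (f : {rmorphism R -> S}).
Implicit Types x y : m.-tuple R.

Lemma map_cat_tuple x y :
  map_tuple f (cat_tuple x y) = cat_tuple (map_tuple f x) (map_tuple f y).
Proof. by apply: val_inj; rewrite /= map_cat. Qed.

Lemma map_witt_add x y :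
  map_tuple f (witt_add p x y) = witt_add p (map_tuple f x) (map_tuple f y).
Proof.
rewrite !witt_add.unlock; apply: eq_from_tnth => i; rewrite tnth_map !tnth_mktuple -map_cat_tuple.
exact: mpoly_at_map.
Qed.

Lemma map_witt_mul x y :
  map_tuple f (witt_mul p x y) = witt_mul p (map_tuple f x) (map_tuple f y).
Proof.
rewrite !witt_mul.unlock; apply: eq_from_tnth => i; rewrite tnth_map !tnth_mktuple -map_cat_tuple.
exact: mpoly_at_map.
Qed.

Lemma map_witt_opp x :
  map_tuple f (witt_opp p x) = witt_opp p (map_tuple f x).
Proof.
rewrite !witt_opp.unlock; apply: eq_from_tnth => i.
by rewrite tnth_map !tnth_mktuple; apply: mpoly_at_map.
Qed.

Lemma map_witt_zero : map_tuple f (witt_zero m R) = witt_zero m S.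
Proof.
by apply: eq_from_tnth => i; rewrite tnth_map !tnth_mktuple rmorph0.
Qed.

Lemma map_witt_one : map_tuple f (witt_one m R) = witt_one m S.
Proof.
by apply: eq_from_tnth => i; rewrite tnth_map !tnth_mktuple rmorph_nat.
Qed.

End Naturality.

(* Identities are checked on generic vectors, where the ghost map is
   injective, and then specialised. *)
Local Notation generic := {mpoly int[m + (m + m)]}.

Lemma genericP (R : comNzRingType) (x y z : m.-tuple R) :
  exists (f : {rmorphism generic -> R}) (t : m.-tuple generic * m.-tuple generic
    * m.-tuple generic),
    [/\ x = map_tuple f t.1.1, y = map_tuple f t.1.2 & z = map_tuple f t.2].
Proof.
pose v := cat_tuple x (cat_tuple y z).
exists (mpoly_at v); exists ([tuple 'X_(lshift _ i) | i < m],
  [tuple 'X_(rshift _ (lshift _ i)) | i < m],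
  [tuple 'X_(rshift _ (rshift _ i)) | i < m]).
split; apply: eq_from_tnth => i; rewrite tnth_map tnth_mktuple;
  apply/esym/(etrans (mpoly_atX v _)).
- by rewrite tnth_lshift.
- by rewrite tnth_rshift tnth_lshift.
- by rewrite !tnth_rshift.
Qed.

Lemma generic_torsion_free (a : generic) : a *+ p = 0 -> a = 0.
Proof.
move=> /mpolyP a0; apply/mpolyP => mu; have /eqP := a0 mu.
rewrite mcoeffMn mcoeff0 -mulr_natr mulf_eq0 pnatr_eq0.
by rewrite (gtn_eqF (prime_gt0 pr_p)) orbF => /eqP.
Qed.

Lemma generic_ghost_inj (X Y : m.-tuple generic) :
  (forall n, (n < m)%N -> ghost p X n = ghost p Y n) -> X = Y.
Proof. exact: ghost_inj generic_torsion_free. Qed.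

Section Laws.
Variable R : comNzRingType.

(* Terms are given explicitly below: letting the unifier compare Witt
   operations makes it unfold them. *)
Lemma witt_addA : associative (@witt_add p m R).
Proof.
move=> x y z; have [f [[[X Y] Z] /= [-> -> ->]]] := genericP x y z.
rewrite -(map_witt_add f Y Z) -(map_witt_add f X) -(map_witt_add f X Y).
rewrite -(map_witt_add f _ Z); apply: (congr1 (map_tuple f)).
apply: generic_ghost_inj => n ltn.
rewrite (ghost_witt_add X _ ltn) (ghost_witt_add Y Z ltn).
rewrite (ghost_witt_add _ Z ltn) (ghost_witt_add X Y ltn); exact: addrA.
Qed.

Lemma witt_addC : commutative (@witt_add p m R).
Proof.
move=> x y; have [f [[[X Y] _] /= [-> -> _]]] := genericP x y x.
rewrite -(map_witt_add f X Y) -(map_witt_add f Y X).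
apply: (congr1 (map_tuple f)); apply: generic_ghost_inj => n ltn.
by rewrite (ghost_witt_add X Y ltn) (ghost_witt_add Y X ltn); exact: addrC.
Qed.

Lemma witt_add0 : left_id (witt_zero m R) (@witt_add p m R).
Proof.
move=> x; have [f [[[X _] _] /= [-> _ _]]] := genericP x x x.
rewrite -(map_witt_zero f) -(map_witt_add f _ X).
apply: (congr1 (map_tuple f)); apply: generic_ghost_inj => n ltn.
by rewrite (ghost_witt_add _ X ltn) (ghost_witt_zero _ n); exact: add0r.
Qed.

Lemma witt_addN :
  left_inverse (witt_zero m R) (@witt_opp p m R) (@witt_add p m R).
Proof.
move=> x; have [f [[[X _] _] /= [-> _ _]]] := genericP x x x.
rewrite -(map_witt_zero f) -(map_witt_opp f X) -(map_witt_add f _ X).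
apply: (congr1 (map_tuple f)); apply: generic_ghost_inj => n ltn.
rewrite (ghost_witt_add _ X ltn) (ghost_witt_opp X ltn) (ghost_witt_zero _ n).
exact: addNr.
Qed.

Lemma witt_mulA : associative (@witt_mul p m R).
Proof.
move=> x y z; have [f [[[X Y] Z] /= [-> -> ->]]] := genericP x y z.
rewrite -(map_witt_mul f Y Z) -(map_witt_mul f X) -(map_witt_mul f X Y).
rewrite -(map_witt_mul f _ Z); apply: (congr1 (map_tuple f)).
apply: generic_ghost_inj => n ltn.
rewrite (ghost_witt_mul X _ ltn) (ghost_witt_mul Y Z ltn).
rewrite (ghost_witt_mul _ Z ltn) (ghost_witt_mul X Y ltn); exact: mulrA.
Qed.

Lemma witt_mulC : commutative (@witt_mul p m R).
Proof.
move=> x y; have [f [[[X Y] _] /= [-> -> _]]] := genericP x y x.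
rewrite -(map_witt_mul f X Y) -(map_witt_mul f Y X).
apply: (congr1 (map_tuple f)); apply: generic_ghost_inj => n ltn.
by rewrite (ghost_witt_mul X Y ltn) (ghost_witt_mul Y X ltn); exact: mulrC.
Qed.

Lemma witt_mul1 : left_id (witt_one m R) (@witt_mul p m R).
Proof.
move=> x; have [f [[[X _] _] /= [-> _ _]]] := genericP x x x.
rewrite -(map_witt_one f) -(map_witt_mul f _ X).
apply: (congr1 (map_tuple f)); apply: generic_ghost_inj => n ltn.
by rewrite (ghost_witt_mul _ X ltn) (ghost_witt_one _ ltn); exact: mul1r.
Qed.

Lemma witt_mulDl : left_distributive (@witt_mul p m R) (@witt_add p m R).
Proof.
move=> x y z; have [f [[[X Y] Z] /= [-> -> ->]]] := genericP x y z.
rewrite -(map_witt_add f X Y) -(map_witt_mul f _ Z) -(map_witt_mul f X Z).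
rewrite -(map_witt_mul f Y Z) -(map_witt_add f (witt_mul p X Z)).
apply: (congr1 (map_tuple f)); apply: generic_ghost_inj => n ltn.
rewrite (ghost_witt_mul _ Z ltn) (ghost_witt_add X Y ltn).
rewrite (ghost_witt_add _ (witt_mul p Y Z) ltn) (ghost_witt_mul X Z ltn).
rewrite (ghost_witt_mul Y Z ltn); exact: mulrDl.
Qed.

End Laws.

End WittTheory.

(* The primality proof is carried by the type because the ring axioms need it. *)
Definition witt (p : nat) (pr_p : prime p) (m : nat) (R : Type) : Type :=
  m.-tuple R.

Section WittRing.
Variables (p : nat) (pr_p : prime p) (m : nat).

HB.instance Definition _ (R : choiceType) :=
  Choice.copy (witt pr_p m R) (m.-tuple R).
HB.instance Definition _ (R : comNzRingType) :=
  GRing.isZmodule.Build (witt pr_p m R) (@witt_addA p pr_p m R)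
    (@witt_addC p pr_p m R) (@witt_add0 p pr_p m R) (@witt_addN p pr_p m R).
HB.instance Definition _ (R : comNzRingType) :=
  GRing.Zmodule_isComPzRing.Build (witt pr_p m R) (@witt_mulA p pr_p m R)
    (@witt_mulC p pr_p m R) (@witt_mul1 p pr_p m R) (@witt_mulDl p pr_p m R).
HB.instance Definition _ (R : finType) :=
  Finite.copy (witt pr_p m R) (m.-tuple R).
HB.instance Definition _ (R : finComNzRingType) :=
  [finGroupMixin of witt pr_p m R for +%R].

Definition witt_coord (R : Type) (x : witt pr_p m R) (i : 'I_m) : R := tnth x i.
Definition witt_seq (R : Type) (x : witt pr_p m R) : seq R := tval x.
Definition mk_witt (R : Type) (F : 'I_m -> R) : witt pr_p m R :=
  [tuple F i | i < m].

Definition witt_map (R S : Type) (f : R -> S) (x : witt pr_p m R) :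
    witt pr_p m S := map_tuple f x.

(* The componentwise power, not the power in the ring of Witt vectors. *)
Definition witt_pow (R : pzSemiRingType) (q : nat) (x : witt pr_p m R) :
    witt pr_p m R := witt_map (fun c => c ^+ q) x.

End WittRing.

(** Valuations and ramification. *)

(* A discrete valuation with value group int; its value at 0, which stands
   for +oo, is irrelevant. *)
Definition discrete_valuation (F : fieldType) (v : F -> int) : Prop :=
  [/\ forall a b, a != 0 -> b != 0 -> v (a * b) = v a + v b,
      forall a b, a != 0 -> b != 0 -> a + b != 0 ->
        (Num.min (v a) (v b) <= v (a + b))%R
    & exists2 t, t != 0 & v t = 1].

(* For a Galois extension all ramification indices above v agree; a finite
   constant field makes residue extensions separable, so e > 1 is the whole
   of ramification. *)
Definition ramified (k : fieldType) (K : fieldExtType k) (v : k -> int) : Prop :=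
  exists (w : K -> int) (e : nat),
    [/\ discrete_valuation w, (1 < e)%N
      & forall c : k, c != 0 -> w c%:A = v c *+ e].

Section RationalFunctions.
Variable k0 : fieldType.
Local Notation k := {fraction {poly k0}}.

(* [repr] need not be a reduced fraction; [prime_val] does not depend on the
   representative. *)
Definition numer (x : k) : {poly k0} := (frac (generic_quotient.repr x)).1.
Definition denom (x : k) : {poly k0} := (frac (generic_quotient.repr x)).2.

(* The exponent of P in f, for f != 0 and P not constant. *)
Definition poly_mult (P f : {poly k0}) : nat :=
  \max_(e < size f | P ^+ e %| f) e.

Definition prime_val (P : {poly k0}) (x : k) : int :=
  (poly_mult P (numer x))%:Z - (poly_mult P (denom x))%:Z.

End RationalFunctions.

(* Main.v *)
Require Import Defs.
From HB Require Import structures.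
From mathcomp Require Import all_boot all_order all_algebra.
From mathcomp Require Import all_fingroup all_solvable all_field.
From mathcomp Require Import ring mpoly.
From mathcomp Require boolp classical_sets.

(** Write q for p^n and F for the Frobenius x |-> x^q, taken componentwise on
    Witt vectors.  The theorem is Witt's version of Artin-Schreier theory,
    followed by a normalization of the right-hand side.

    Existence of y.  The isomorphism of the Galois group G with W_m(F_q),
    composed with W_m(F_q) -> W_m(k) -> W_m(K), is a 1-cocycle c, since G acts
    trivially on its values.  By additive Hilbert 90 for Witt vectors
    [witt_Hilbert_90] there is y with u(y) - y = c(u) for all u in G.  As F
    fixes c(u), the vector beta = F(y) - y is G-invariant, so it lies in W_m(k).
    Since c is injective, only the identity fixes y, so K = k(y); since c is
    onto, the first entry of y has the q conjugates y_1 + a, with a in F_q, so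
    X^q - X - beta_1 is irreducible.  All of this remains true when y is
    replaced by y + a with a in W_m(k), which adds F(a) - a to beta.

    Normalization.  The entries of beta are treated in increasing order
    [normalize_step].  The vectors whose first j entries vanish form a subgroup
    of W_m on which the j-th entry is additive; so once the first j entries of
    beta have the required form, changing y by a vector supported in position j
    changes the j-th entry of the remainder by a^q - a and leaves the earlier
    ones alone.  Hence only a statement about a single element x of k is needed
    [partial_fractions], [normalize_degree]: modulo elements a^q - a, it is a
    sum of proper fractions f / D^e, over finitely many primes D, with q not
    dividing e, and of a polynomial that is constant or of degree not divisible
    by q.  A term with q | e is lowered because every residue modulo D is a q-th
    power, the residue field being finite; likewise for leading coefficients.

    Ramification.  The primes D that occur must be among the P_i
    [no_unramified_witt_pole].  The D-adic valuation extends to a discrete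
    valuation w of K [extend_discrete_valuation]; if D is unramified, w has the
    same value group.  The entries of y before position j are integral at w, by
    integral closedness, so y_j^q - y_j has the same principal part as the term
    f / D^e, and comparing valuations gives e = - q w(y_j), contradicting the
    fact that q does not divide e. *)

Set Implicit Arguments.
Unset Strict Implicit.
Unset Printing Implicit Defensive.

Import Order.TTheory GRing.Theory Num.Theory.
Local Open Scope ring_scope.

(** * Entries of Witt vectors *)

Section WittCoordinates.
Variables (p : nat) (pr_p : prime p) (m : nat).

Definition wcoef (R : nmodType) (x : witt pr_p m R) (i : nat) : R :=
  (witt_seq x)`_i.

Lemma wcoef_mk (R : nmodType) (F : 'I_m -> R) (i : 'I_m) :
  wcoef (mk_witt pr_p F) i = F i.
Proof. by rewrite /wcoef /witt_seq -tnth_nth tnth_mktuple. Qed.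

Lemma wcoef_coord (R : nmodType) (x : witt pr_p m R) (i : 'I_m) :
  witt_coord x i = wcoef x i.
Proof. by rewrite /witt_coord (tnth_nth 0). Qed.

Lemma wcoef_ge (R : nmodType) (x : witt pr_p m R) i :
  (m <= i)%N -> wcoef x i = 0.
Proof. by move=> le_mi; rewrite /wcoef nth_default ?size_tuple. Qed.

Lemma wcoefP (R : nmodType) (x y : witt pr_p m R) :
  (forall i, (i < m)%N -> wcoef x i = wcoef y i) -> x = y.
Proof.
move=> exy; apply: eq_from_tnth => i.
by rewrite !(tnth_nth 0); apply: exy.
Qed.

Lemma wcoef_map (R S : nmodType) (f : {additive R -> S})
    (x : witt pr_p m R) i :
  wcoef (witt_map f x) i = f (wcoef x i).
Proof.
have [lt_im | le_mi] := ltnP i m; last by rewrite !wcoef_ge ?raddf0.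
by rewrite /wcoef /witt_seq /= (nth_map 0) ?size_tuple.
Qed.

Lemma wcoef0 (R : comNzRingType) i : wcoef (0 : witt pr_p m R) i = 0.
Proof. exact: nth_witt_zero. Qed.

Definition wtrunc (R : nmodType) j (x : witt pr_p m R) : witt pr_p m R :=
  mk_witt pr_p (fun i : 'I_m => if (i < j)%N then wcoef x i else 0).
Definition wtail (R : nmodType) j (x : witt pr_p m R) : witt pr_p m R :=
  mk_witt pr_p (fun i : 'I_m => if (i < j)%N then 0 else wcoef x i).
(** The vector a placed in position j: the iterated Verschiebung of the
    Teichmueller representative of a. *)
Definition wsingle (R : nmodType) j (a : R) : witt pr_p m R :=
  mk_witt pr_p (fun i : 'I_m => if (i == j :> nat) then a else 0).

Lemma wcoef_trunc (R : nmodType) j (x : witt pr_p m R) i :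
  wcoef (wtrunc j x) i = if (i < j)%N then wcoef x i else 0.
Proof.
have [lt_im | le_mi] := ltnP i m; last by rewrite !wcoef_ge ?if_same.
exact: (wcoef_mk _ (Ordinal lt_im)).
Qed.

Lemma wcoef_tail (R : nmodType) j (x : witt pr_p m R) i :
  wcoef (wtail j x) i = if (i < j)%N then 0 else wcoef x i.
Proof.
have [lt_im | le_mi] := ltnP i m; last by rewrite !wcoef_ge ?if_same.
exact: (wcoef_mk _ (Ordinal lt_im)).
Qed.

Lemma wcoef_single (R : nmodType) j (a : R) i : (i < m)%N ->
  wcoef (wsingle j a) i = if i == j then a else 0.
Proof. by move=> lt_im; apply: (wcoef_mk _ (Ordinal lt_im)). Qed.

Lemma wcoef_single_lt (R : nmodType) j (a : R) i : (i < j)%N ->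
  wcoef (wsingle j a) i = 0.
Proof.
move=> lt_ij; have [lt_im | le_mi] := ltnP i m; last by rewrite wcoef_ge.
by rewrite wcoef_single // ltn_eqF.
Qed.

Lemma map_wsingle (R S : nmodType) (f : {additive R -> S}) j (a : R) :
  witt_map f (wsingle j a) = wsingle j (f a).
Proof.
apply: wcoefP => i lt_im; rewrite wcoef_map !wcoef_single //.
by case: ifP => // _; rewrite raddf0.
Qed.

Lemma witt_map_comp (R S T : Type) (f : R -> S) (g : S -> T)
    (x : witt pr_p m R) : witt_map g (witt_map f x) = witt_map (g \o f) x.
Proof. by apply: val_inj; rewrite /= -map_comp. Qed.

Lemma eq_witt_map (R S : Type) (f g : R -> S) (x : witt pr_p m R) :
  f =1 g -> witt_map f x = witt_map g x.
Proof. by move=> efg; apply: val_inj; apply: eq_map. Qed.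

Lemma witt_map_is_zmod (R S : comNzRingType) (f : {rmorphism R -> S}) :
  zmod_morphism (witt_map f : witt pr_p m R -> witt pr_p m S).
Proof.
move=> x y; rewrite -[RHS]/(witt_add p (map_tuple f x)
  (witt_opp p (map_tuple f y))).
by rewrite -(map_witt_opp p f y) -(map_witt_add p f x).
Qed.

HB.instance Definition _ (R S : comNzRingType) (f : {rmorphism R -> S}) :=
  GRing.isZmodMorphism.Build _ _ (witt_map f : witt pr_p m R -> witt pr_p m S)
    (witt_map_is_zmod f).

Lemma expp_ord_eq0 k : (p ^ k == 0)%N = false.
Proof. by rewrite expn_eq0 (gtn_eqF (prime_gt0 pr_p)). Qed.

(** The ghost equations are triangular: the i-th one determines the i-th entry
    from the earlier ones, up to p-torsion. *)
Lemma ghost_inj_upto (R : comNzRingType) (x y : seq R) j :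
    (forall a : R, a *+ p = 0 -> a = 0) ->
    (forall n, (n <= j)%N -> ghost p x n = ghost p y n) ->
  forall i, (i <= j)%N -> x`_i = y`_i.
Proof.
move=> tfR exy; pose c (z : seq R) := [tuple z`_(i : 'I_j.+1) | i < j.+1].
have cE z i : (i <= j)%N -> (c z)`_i = z`_i.
  move=> le_ij; have ->: i = @Ordinal j.+1 i le_ij by [].
  by rewrite -tnth_nth tnth_mktuple.
have ghc z n : (n <= j)%N -> ghost p (c z) n = ghost p z n.
  by move=> le_nj; apply: ghost_ext => i le_in; rewrite cE ?(leq_trans le_in).
have Ec : c x = c y.
  by apply: (ghost_inj (p := p)) => // n lt_nj; rewrite !ghc // exy.
by move=> i le_ij; rewrite -cE // Ec cE.
Qed.

(** Identities between Witt vectors can be checked through ghost components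
    after lifting to a ring without p-torsion. *)
Lemma witt_liftP (R : comNzRingType) (x y : witt pr_p m R) :
  exists (A : comNzRingType) (f : {rmorphism A -> R}) (X Y : witt pr_p m A),
    [/\ forall a : A, a *+ p = 0 -> a = 0, x = witt_map f X
      & y = witt_map f Y].
Proof.
have [f [[[X Y] _] /= [Dx Dy _]]] := genericP x y x.
exists (mpoly.mpoly (m + (m + m)) int : comNzRingType), f, X, Y.
by split=> //; apply: generic_torsion_free.
Qed.

(** Ghost components are sums of terms each involving one entry, so they add
    up when two vectors have disjoint supports: Witt addition is then
    concatenation. *)
Lemma wtrunc_tail (R : comNzRingType) j (x : witt pr_p m R) :
  wtrunc j x + wtail j x = x.
Proof.
have [A [f [X [_ [tfA Dx _]]]]] := witt_liftP x x.
have ->: wtrunc j x = witt_map f (wtrunc j X).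
  apply: wcoefP => i _; rewrite Dx wcoef_trunc !wcoef_map wcoef_trunc.
  by case: ifP => // _; rewrite raddf0.
have ->: wtail j x = witt_map f (wtail j X).
  apply: wcoefP => i _; rewrite Dx wcoef_tail !wcoef_map wcoef_tail.
  by case: ifP => // _; rewrite raddf0.
rewrite -raddfD [RHS]Dx; congr (witt_map f _).
apply: (@ghost_inj p m A) => // n lt_nm; rewrite ghost_witt_add //.
rewrite /ghost -big_split; apply: eq_bigr => i _.
have := wcoef_trunc j X i; have := wcoef_tail j X i.
rewrite /wcoef /witt_seq => -> ->; case: ifP => _.
  by rewrite expr0n expp_ord_eq0 mul0rn; apply: addr0.
by rewrite expr0n expp_ord_eq0 mul0rn; apply: add0r.
Qed.

(** The filtration of W_m by the images V^j W_(m - j) of the iterated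
    Verschiebung. *)
Definition wfil (R : nmodType) j (x : witt pr_p m R) :=
  forall i, (i < j)%N -> wcoef x i = 0.

Lemma wfil_tail (R : nmodType) j (x : witt pr_p m R) : wfil j (wtail j x).
Proof. by move=> i lt_ij; rewrite wcoef_tail lt_ij. Qed.

(** For vectors that vanish before position j, the ghost component of index
    j is p^j times the entry j, so this entry is additive. *)
Lemma wcoefD_lead (R : comNzRingType) j (x y : witt pr_p m R) :
  wfil j x -> wfil j y -> wcoef (x + y) j = wcoef x j + wcoef y j.
Proof.
move=> fx fy; have [lt_jm|le_mj] := ltnP j m; last by rewrite !wcoef_ge ?addr0.
have [A [f [X [Y [tfA Dx Dy]]]]] := witt_liftP x y.
have tailE (z : witt pr_p m R) (Z : witt pr_p m A) : z = witt_map f Z ->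
    wfil j z -> z = witt_map f (wtail j Z).
  move=> Dz fz; apply: wcoefP => i _; rewrite wcoef_map wcoef_tail.
  by case: ifP => [/fz->|_]; rewrite ?raddf0 // Dz wcoef_map.
rewrite (tailE x X) // (tailE y Y) // -raddfD !wcoef_map -raddfD.
move: (wtail j X) (wtail j Y) (wfil_tail (j := j) X) (wfil_tail (j := j) Y).
move=> {Dx Dy}X' Y' fX fY; congr (f _).
pose Z : witt pr_p m A := wsingle j (wcoef X' j + wcoef Y' j).
suff /(_ j (leqnn j)): forall i, (i <= j)%N ->
    (witt_seq (X' + Y'))`_i = (witt_seq Z)`_i.
  by rewrite -/(wcoef Z j) wcoef_single // eqxx.
apply: ghost_inj_upto => //.
move=> n le_nj; rewrite ghost_witt_add //; last exact: leq_ltn_trans lt_jm.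
rewrite /ghost -big_split; apply: eq_bigr => i _.
rewrite -/(witt_seq X') -/(witt_seq Y') -/(wcoef X' i) -/(wcoef Y' i).
rewrite -/(wcoef Z i); have: (i <= j)%N by apply: leq_trans le_nj; rewrite -ltnS.
rewrite leq_eqVlt => /predU1P[Di|lt_ij]; last first.
  rewrite fX // fY // wcoef_single_lt // expr0n expp_ord_eq0 mul0rn.
  exact: addr0.
have ->: (n - i = 0)%N by apply/eqP; rewrite subn_eq0 Di.
by rewrite expn0 !expr1 Di wcoef_single // eqxx mulrnDl.
Qed.

Lemma wfilD (R : comNzRingType) j (x y : witt pr_p m R) :
  wfil j x -> wfil j y -> wfil j (x + y).
Proof.
move=> fx fy i lt_ij; have [fx' fy'] : wfil i x /\ wfil i y.
  by split=> k lt_ki; [apply: fx|apply: fy]; apply: ltn_trans lt_ij.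
by rewrite wcoefD_lead // fx // fy // addr0.
Qed.

(** Induction on the position, using only additivity of the leading entry in
    x + (- x) = 0. *)
Lemma wfilN (R : comNzRingType) j (x : witt pr_p m R) :
  wfil j x -> wfil j (- x).
Proof.
elim: j => [|j IHj] fx i; first by [].
have fx' : wfil j x by move=> k lt_kj; apply/fx/ltnW.
rewrite ltnS leq_eqVlt => /predU1P[->|]; last exact: IHj.
have := wcoefD_lead fx' (IHj fx'); rewrite subrr wcoef0 fx // add0r.
by move/esym.
Qed.

Lemma wcoefN_lead (R : comNzRingType) j (x : witt pr_p m R) :
  wfil j x -> wcoef (- x) j = - wcoef x j.
Proof.
move=> fx; have := wcoefD_lead fx (wfilN fx); rewrite subrr wcoef0.
by move/esym/eqP; rewrite addrC addr_eq0 => /eqP.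
Qed.

Lemma wfilB (R : comNzRingType) j (x y : witt pr_p m R) :
  wfil j x -> wfil j y -> wfil j (x - y).
Proof. by move=> fx fy; apply: wfilD => //; apply: wfilN. Qed.

Lemma wcoefB_lead (R : comNzRingType) j (x y : witt pr_p m R) :
  wfil j x -> wfil j y -> wcoef (x - y) j = wcoef x j - wcoef y j.
Proof. by move=> fx fy; rewrite wcoefD_lead ?wcoefN_lead //; apply: wfilN. Qed.

Lemma wfil_sum (R : comNzRingType) j I (r : seq I) (F : I -> witt pr_p m R) :
  (forall i, wfil j (F i)) -> wfil j (\sum_(i <- r) F i).
Proof.
move=> fF; apply: big_ind => //; last exact: wfilD.
by move=> i _; rewrite wcoef0.
Qed.

Lemma wcoef_sum_lead (R : comNzRingType) j I (r : seq I)
    (F : I -> witt pr_p m R) :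
  (forall i, wfil j (F i)) ->
  wcoef (\sum_(i <- r) F i) j = \sum_(i <- r) wcoef (F i) j.
Proof.
move=> fF; elim: r => [|i r IHr]; first by rewrite !big_nil wcoef0.
by rewrite !big_cons wcoefD_lead ?IHr //; apply: wfil_sum.
Qed.

Lemma wfil_single (R : nmodType) j (a : R) : wfil j (wsingle j a).
Proof. by move=> i; apply: wcoef_single_lt. Qed.

Lemma wfilS (R : nmodType) j (x : witt pr_p m R) :
  wfil j x -> wcoef x j = 0 -> wfil j.+1 x.
Proof.
by move=> fx xj i; rewrite ltnS leq_eqVlt => /predU1P[->|/fx].
Qed.

Lemma wfil_full (R : comNzRingType) (x : witt pr_p m R) : wfil m x -> x = 0.
Proof. by move=> fx; apply: wcoefP => i /fx ->; rewrite wcoef0. Qed.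

(** Adding to a vector supported before j one supported from j on juxtaposes
    the two. *)
Lemma wcoefD_glue (R : comNzRingType) j (x u : witt pr_p m R) i :
  wfil j u ->
  wcoef (wtrunc j x + u) i = if (i < j)%N then wcoef x i else wcoef u i.
Proof.
move=> fu; pose w : witt pr_p m R :=
  mk_witt pr_p (fun i : 'I_m => if (i < j)%N then wcoef x i else wcoef u i).
have wE k : wcoef w k = if (k < j)%N then wcoef x k else wcoef u k.
  have [lt_km | le_mk] := ltnP k m; last by rewrite !wcoef_ge ?if_same.
  exact: (wcoef_mk _ (Ordinal lt_km)).
rewrite -wE -(wtrunc_tail j w); congr (wcoef (_ + _) i).
  by apply: wcoefP => k _; rewrite !wcoef_trunc wE; case: ifP.
by apply: wcoefP => k _; rewrite wcoef_tail wE; case: (ltnP k j) => // /fu.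
Qed.

(** Correcting a vector from position j on leaves the earlier entries intact
    and is additive at j; this is what makes an entry-by-entry construction
    possible. *)
Lemma wcoefD_fil (R : comNzRingType) j (x z : witt pr_p m R) i :
  wfil j z -> (i <= j)%N -> wcoef (x + z) i = wcoef x i + wcoef z i.
Proof.
move=> fz le_ij; have fi : wfil i z.
  by move=> k lt_ki; apply: fz; apply: leq_trans le_ij.
have ft := wfil_tail (j := i) x.
rewrite -{1}(wtrunc_tail i x) -addrA wcoefD_glue ?ltnn; last exact: wfilD.
by rewrite wcoefD_lead // wcoef_tail ltnn.
Qed.

Lemma wcoefD0 (R : comNzRingType) (x y : witt pr_p m R) :
  wcoef (x + y) 0 = wcoef x 0 + wcoef y 0.
Proof. exact: (@wcoefD_lead _ 0). Qed.

Section Subring.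
Variables (R : comNzRingType) (S : R -> Prop).
Hypotheses (S1 : S 1) (SB : forall a b, S a -> S b -> S (a - b)).
Hypothesis SM : forall a b, S a -> S b -> S (a * b).

Lemma sring0 : S 0. Proof. by rewrite -(subrr 1); apply: SB. Qed.
Lemma sringN a : S a -> S (- a).
Proof. by move=> Sa; rewrite -sub0r; apply: SB => //; apply: sring0. Qed.
Lemma sringD a b : S a -> S b -> S (a + b).
Proof. by move=> Sa Sb; rewrite -[b]opprK; apply: SB => //; apply: sringN. Qed.
Lemma sringX a n : S a -> S (a ^+ n).
Proof. by move=> Sa; elim: n => // n IHn; rewrite exprS; apply: SM. Qed.
Lemma sring_sum I (r : seq I) (P : pred I) (F : I -> R) :
  (forall i, P i -> S (F i)) -> S (\sum_(i <- r | P i) F i).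
Proof. by move=> SF; apply: big_ind => //; [apply: sring0|apply: sringD]. Qed.
Lemma sring_prod I (r : seq I) (P : pred I) (F : I -> R) :
  (forall i, P i -> S (F i)) -> S (\prod_(i <- r | P i) F i).
Proof. by move=> SF; apply: big_ind. Qed.
Lemma sring_int (z : int) : S z%:~R.
Proof.
have Sn n : S n%:R.
  by elim: n => [|n]; [apply: sring0 | rewrite mulrSr => /sringD; apply].
by case: z => n; [apply: Sn|rewrite NegzE mulrNz; apply/sringN/Sn].
Qed.

Lemma sring_mpoly_at N (x : N.-tuple R) P :
  (forall i, S (tnth x i)) -> S (mpoly_at x P).
Proof.
move=> Sx; rewrite /mpoly_at /mpoly.mmap; apply: sring_sum => mu _.
apply: SM; first exact: sring_int.
by apply: sring_prod => i _; apply: sringX.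
Qed.

(** W_m(S) inside W_m(R). *)
Definition wover (x : witt pr_p m R) := forall i, S (wcoef x i).

Lemma wover_tnth x : wover x -> forall i : 'I_m, S (tnth x i).
Proof. by move=> Sx i; rewrite (tnth_nth 0); apply: Sx. Qed.

Lemma tnth_wover (x : witt pr_p m R) :
  (forall i : 'I_m, S (tnth x i)) -> wover x.
Proof.
move=> Sx i; have [lt_im | le_mi] := ltnP i m; last first.
  by rewrite wcoef_ge //; apply: sring0.
by have := Sx (Ordinal lt_im); rewrite (tnth_nth 0).
Qed.

Lemma woverD x y : wover x -> wover y -> wover (x + y).
Proof.
move=> Sx Sy; apply: tnth_wover => i; rewrite -[x + y]/(witt_add p x y).
rewrite witt_add.unlock tnth_mktuple; apply: sring_mpoly_at => k.
by case: (split_ordP k) => l ->; rewrite ?tnth_lshift ?tnth_rshift;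
  apply: wover_tnth.
Qed.

Lemma wover_sum I (r : seq I) (F : I -> witt pr_p m R) :
  (forall i, wover (F i)) -> wover (\sum_(i <- r) F i).
Proof.
move=> SF; apply: big_ind => // [i|]; last exact: woverD.
by rewrite wcoef0; apply: sring0.
Qed.

Lemma wover_trunc j (x : witt pr_p m R) :
  (forall i, (i < j)%N -> S (wcoef x i)) -> wover (wtrunc j x).
Proof.
by move=> Sx i; rewrite wcoef_trunc; case: ifP => [/Sx|] // _; apply: sring0.
Qed.

(** The entry j of a Witt sum is the sum of the entries j plus a polynomial in
    the earlier ones; splitting off the truncations of x and y avoids
    writing this polynomial down. *)
Lemma wcoefD_mod j x y :
    (forall i, (i < j)%N -> S (wcoef x i)) ->
    (forall i, (i < j)%N -> S (wcoef y i)) ->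
  S (wcoef (x + y) j - (wcoef x j + wcoef y j)).
Proof.
move=> /wover_trunc Sx /wover_trunc Sy.
rewrite -{1}(wtrunc_tail j x) -{1}(wtrunc_tail j y) addrACA.
have fx := wfil_tail (j := j) x; have fy := wfil_tail (j := j) y.
rewrite (wcoefD_fil _ (wfilD fx fy)) // wcoefD_lead // !wcoef_tail ltnn addrK.
exact: woverD.
Qed.

End Subring.

End WittCoordinates.

(** * Extension of discrete valuations *)

Section MaximalSubring.
Variables (K : fieldType) (pi : K) (S : K -> Prop).
Hypotheses (S1 : S 1) (SB : forall a b, S a -> S b -> S (a - b)).
Hypotheses (SM : forall a b, S a -> S b -> S (a * b)).
Hypotheses (Spi : S pi) (Sni : ~ S pi^-1).
Hypothesis Smax : forall x, ~ S x ->
  exists2 f : {poly K}, (forall i, S f`_i) & pi^-1 = f.[x].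

Let S0 := sring0 S1 SB.
Let SN := sringN S1 SB.
Let SD := sringD S1 SB.
Let SX := sringX S1 SM.

Let pi_neq0 : pi != 0.
Proof. by apply: contra_not_neq Sni => ->; rewrite invr0. Qed.

(** Otherwise 1/pi would be a polynomial in (1 - pi a)^-1 over S; clearing
    denominators, where (1 - pi a)^N is 1 modulo pi S, puts 1/pi in S. *)
Lemma max_subring_local a : S a -> S (1 - pi * a)^-1.
Proof.
move=> Sa; set u := 1 - _; have [->|u0] := eqVneq u 0; first by rewrite invr0.
have Su : S u by apply/SB/SM.
apply: boolp.contrapT => /Smax[f Sf fu]; apply: Sni.
have [s Ss Dun]: exists2 s, S s & u ^+ (size f) = 1 - pi * s.
  elim: (size f) => [|n [s Ss Es]]; first by exists 0; rewrite ?mulr0 ?subr0.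
  exists (a + s - pi * a * s); first by apply: SB; [apply: SD|apply/SM/Ss/SM].
  by rewrite exprS Es /u !mulrBl !mul1r mulrBr mulrDr !mulr1; ring.
have: S (u ^+ (size f) * pi^-1).
  rewrite fu horner_coef mulr_sumr; apply: (sring_sum S1 SB) => i _.
  rewrite mulrCA; apply: SM => //; rewrite exprVn -expfB //.
  exact: SX.
by rewrite Dun mulrBl mul1r mulrAC divff // mul1r => /SD/(_ Ss); rewrite subrK.
Qed.

(** The relation 1/pi = g(1/x) expresses x^n, for n the degree of f, through
    lower powers of x, with coefficients in S because 1 - pi g_0 is a unit;
    substituting for the leading term of f lowers its degree. *)
Lemma max_subring_reduce x (f g : {poly K}) : x != 0 ->
    (forall i, S f`_i) -> (forall i, S g`_i) ->
    pi^-1 = f.[x] -> pi^-1 = g.[x^-1] -> (size g <= size f)%N ->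
  exists2 h : {poly K}, (forall i, S h`_i) &
    pi^-1 = h.[x] /\ (size h < size f)%N.
Proof.
move=> x0 Sf Sg fx gx le_gf.
have szf : (0 < size f)%N.
  rewrite lt0n size_poly_eq0; apply/negP=> /eqP f0.
  by case: Sni; rewrite fx f0 horner0.
case Dn: (size f) szf le_gf => [//|n] _ le_gn.
pose u := 1 - pi * g`_0; have Su' : S u^-1 by apply: max_subring_local.
have u0 : u != 0.
  apply: contra_not_neq Sni => u0; suff ->: pi^-1 = g`_0 by [].
  move/eqP: u0; rewrite subr_eq0 => /eqP u0.
  by apply: (mulfI pi_neq0); rewrite divff.
(* the lower part of f, plus f_n x^n rewritten through g *)
pose h := \poly_(i < n) (f`_i + f`_n * pi * u^-1 * g`_(n - i)).
exists h; last split; last by rewrite ltnS size_poly.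
  move=> i; rewrite coef_poly; case: ifP => // _; apply: SD => //.
  by do !apply: SM => //.
rewrite fx horner_coef Dn big_ord_recr horner_poly /=.
under [RHS]eq_bigr do rewrite mulrDl; rewrite big_split /=; congr (_ + _).
suff ->: x ^+ n = pi * u^-1 * \sum_(i < n) g`_(n - i) * x ^+ i.
  by rewrite !mulr_sumr; apply: eq_bigr => i _; rewrite !mulrA.
have: u * pi^-1 = \sum_(i < n) g`_i.+1 * x^-1 ^+ i.+1.
  rewrite mulrBl mul1r mulrAC divff // mul1r gx.
  rewrite (horner_coef_wide _ le_gn) big_ord_recl expr0 mulr1 /= addrAC subrr.
  by rewrite add0r.
move/(congr1 (fun z => pi * u^-1 * (z * x ^+ n))).
rewrite -[u / pi * _]mulrA -!mulrA (mulKf u0) mulVKf // => ->.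
do 2 congr (_ * _); rewrite mulr_suml (reindex_inj rev_ord_inj) /=.
apply: eq_bigr => i _; rewrite -mulrA subnSK //; congr (_ * _).
rewrite exprVn mulrC; apply: (canLR (mulfK _)); first by rewrite expf_neq0.
by rewrite -exprD subnKC // ltnW.
Qed.

(** Chevalley's argument: if neither x nor 1/x were in S, maximality would give
    1/pi as a polynomial in each of them, and the two expressions could be
    used to shorten one another forever. *)
Lemma max_subring_valuation x : S x \/ S x^-1.
Proof.
have [->|x0] := eqVneq x 0; first by left.
apply: boolp.contrapT => /boolp.not_orP[/Smax[f Sf fx] /Smax[g Sg gx]].
have [N] := ubnP (size f + size g).
elim: N x x0 f Sf fx g Sg gx => // N IHN x x0 f Sf fx g Sg gx.
rewrite ltnS => le_N; have [le_gf|/ltnW le_fg] := leqP (size g) (size f).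
  have [h Sh [hx lt_hf]] := max_subring_reduce x0 Sf Sg fx gx le_gf.
  by apply: (IHN x x0 h Sh hx g); rewrite // (leq_trans _ le_N) // ltn_add2r.
have xV0 : x^-1 != 0 by rewrite invr_eq0.
have [|h Sh [hx lt_hf]] := max_subring_reduce xV0 Sg Sf gx _ le_fg.
  by rewrite invrK.
apply: (IHN x x0 f Sf fx h) => //.
by rewrite (leq_trans _ le_N) // ltn_add2l.
Qed.

End MaximalSubring.

(** Zorn's lemma for subrings in which pi stays a non-unit.  For x outside a
    maximal such S, the ring S[x] must contain 1/pi. *)
Lemma exists_max_subring (K : fieldType) (pi : K) (O : K -> Prop) :
    O 1 -> (forall a b, O a -> O b -> O (a - b)) ->
    (forall a b, O a -> O b -> O (a * b)) -> ~ O pi^-1 ->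
  exists S : K -> Prop,
    [/\ S 1 /\ (forall a b, S a -> S b -> S (a - b)),
        forall a b, S a -> S b -> S (a * b),
        forall a, O a -> S a, ~ S pi^-1
      & forall x, ~ S x ->
          exists2 f : {poly K}, (forall i, S f`_i) & pi^-1 = f.[x]].
Proof.
move=> O1 OB OM Oni.
pose valid (S : K -> Prop) :=
  [/\ forall a b, S a -> S b -> S (a - b),
      forall a b, S a -> S b -> S (a * b),
      forall a, O a -> S a & ~ S pi^-1].
(* Nonemptiness is a premise so that the empty chain has its union in P. *)
pose P (S : K -> Prop) := (exists a, S a) -> valid S.
have [F sFP Ftot|A [PA Amax]] := @classical_sets.Zorn_bigcup K P.
  have FV X a : F X -> X a -> valid X by move=> FX Xa; apply: (sFP X FX); exists a.
  move=> [a0 [X0 FX0 X0a0]].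
  have both a b : classical_sets.bigcup F id a -> classical_sets.bigcup F id b ->
      exists X, [/\ F X, X a & X b].
    move=> [X FX Xa] [Y FY Yb]; have [sXY|sYX] := Ftot X Y FX FY.
      by exists Y; split=> //; apply: sXY.
    by exists X; split=> //; apply: sYX.
  split=> [a b Fa Fb|a b Fa Fb|a Oa|[X FX Xn]].
  - have [X [FX Xa Xb]] := both a b Fa Fb; exists X => //.
    by have [XB _ _ _] := FV X a FX Xa; apply: XB.
  - have [X [FX Xa Xb]] := both a b Fa Fb; exists X => //.
    by have [_ XM _ _] := FV X a FX Xa; apply: XM.
  - by have [_ _ OX _] := FV X0 a0 FX0 X0a0; exists X0 => //; apply: OX.
  - by have [_ _ _] := FV X _ FX Xn.
have OV : valid O by split.
have [a Aa] : exists a, A a.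
  apply: boolp.contrapT => nA; apply: (Amax O) => //; split=> [a Aa|sOA].
    by case: nA; exists a.
  by apply: nA; exists 1; apply: sOA.
have [AB AM OA Ani] := PA (ex_intro _ a Aa).
have A1 := OA 1 O1; have A0 := sring0 A1 AB.
exists A; split=> // x nAx; apply: boolp.contrapT => nf.
pose B z := exists2 f : {poly K}, (forall i, A f`_i) & z = f.[x].
apply: (Amax B); first split.
- by move=> b Ab; exists b%:P => [i|]; rewrite ?hornerC // coefC; case: ifP.
- move=> sBA; apply/nAx/sBA; exists 'X => [i|]; rewrite ?hornerX // coefX.
  by case: (i == 1)%N.
move=> _; split=> //.
- move=> _ _ [f Af ->] [g Ag ->]; exists (f - g) => [i|]; last by rewrite !hornerE.
  by rewrite coefB; apply: AB.
- move=> _ _ [f Af ->] [g Ag ->]; exists (f * g) => [i|]; last by rewrite hornerM.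
  by rewrite coefM; apply: (sring_sum A1 AB) => j _; apply: AM.
- move=> b Ob; exists b%:P => [i|]; rewrite ?hornerC // coefC.
  by case: ifP => // _; apply: OA.
Qed.

Section ValuationRing.
Variables (K : fieldType) (S : K -> Prop).
Hypotheses (S1 : S 1) (SB : forall a b, S a -> S b -> S (a - b)).
Hypotheses (SM : forall a b, S a -> S b -> S (a * b)).
Hypothesis Sval : forall x, S x \/ S x^-1.

Let S0 := sring0 S1 SB.
Let SN := sringN S1 SB.
Let SD := sringD S1 SB.
Let SX := sringX S1 SM.

Definition runit (u : K) := [/\ u != 0, S u & S u^-1].

Lemma runitM u v : runit u -> runit v -> runit (u * v).
Proof.
move=> [u0 Su Su'] [v0 Sv Sv']; split; rewrite ?mulf_neq0 ?invfM //; exact: SM.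
Qed.

Lemma runitV u : runit u -> runit u^-1.
Proof. by move=> [u0 Su Su']; split; rewrite ?invr_eq0 ?invrK. Qed.

Lemma runitX u n : runit u -> runit (u ^+ n).
Proof.
by move=> [u0 Su Su']; split; rewrite ?expf_neq0 -?exprVn //; apply: SX.
Qed.

Lemma runit_root u n : (0 < n)%N -> runit (u ^+ n) -> runit u.
Proof.
have key v : v != 0 -> (0 < n)%N -> S (v ^+ n) -> S v.
  move=> v0 n_gt0 Sv; have [//|Sv'] := Sval v.
  have ->: v = v ^+ n * v^-1 ^+ n.-1; last by apply: SM => //; apply: SX.
  by rewrite -(prednK n_gt0) exprS exprVn mulfK // expf_neq0.
move=> n_gt0 [un0 Su Su']; have u0 : u != 0.
  by apply: contraNneq un0 => ->; rewrite expr0n (gtn_eqF n_gt0).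
split=> //; first exact: key.
by apply: key; rewrite ?invr_eq0 // exprVn.
Qed.

Definition nonunit (a : K) := S a /\ (S a^-1 -> a = 0).

Lemma nonunitD a b : nonunit a -> nonunit b -> nonunit (a + b).
Proof.
wlog Sab : a b / S (a / b).
  move=> IH; case: (Sval (a / b)) => [/IH//|]; rewrite invf_div => Sba Na Nb.
  by rewrite addrC; apply: IH.
move=> [Sa a0] [Sb b0]; split; first exact: SD.
have [Db|nb0] := eqVneq b 0; first by rewrite Db addr0.
move=> Sc; have Dab : a + b = b * (a / b + 1).
  by rewrite mulrDr mulr1 mulrCA divff ?mulr1.
have [//|nab] := eqVneq (a + b) 0.
suff /b0/eqP: S b^-1 by rewrite (negPf nb0).
have ->: b^-1 = (a + b)^-1 * (a / b + 1).
  by apply: (mulfI nb0); rewrite divff // mulrCA -Dab mulVf.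
by apply: SM => //; apply: SD.
Qed.

Lemma nonunit_sum I (r : seq I) (P : pred I) (F : I -> K) :
  (forall i, P i -> nonunit (F i)) -> nonunit (\sum_(i <- r | P i) F i).
Proof. by move=> NF; apply: big_ind => //; apply: nonunitD. Qed.

(** Divisibility in a valuation ring is total, so a finite family has an
    element that divides all the others. *)
Lemma exists_dominant (I : eqType) (r : seq I) (F : I -> K) :
    (exists2 i, i \in r & F i != 0) ->
  exists i, [/\ i \in r, F i != 0 & forall j, j \in r -> S (F j / F i)].
Proof.
elim: r => [|i r IHr]; first by case.
have [[k kr Fk0] _|nr] := boolp.pselect (exists2 i, i \in r & F i != 0).
  have [|l [lr Fl0 Fl]] := IHr; first by exists k.
  have [Sil|Sli] := Sval (F i / F l).
    exists l; split=> // [|j]; first by rewrite inE lr orbT.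
    by rewrite inE => /predU1P[->|/Fl].
  have [Fi0|Fi0] := eqVneq (F i) 0.
    exists l; split=> // [|j]; first by rewrite inE lr orbT.
    by rewrite inE => /predU1P[->|/Fl] //; rewrite Fi0 mul0r.
  exists i; split=> // [|j]; first by rewrite inE eqxx.
  rewrite inE => /predU1P[->|/Fl Sj]; first by rewrite divff.
  rewrite invf_div in Sli; have := SM Sj Sli.
  by rewrite mulrA divfK.
move=> [k]; rewrite inE => /predU1P[-> Fi0|kr Fk0]; last by case: nr; exists k.
exists i; split=> // [|j]; first by rewrite inE eqxx.
rewrite inE => /predU1P[->|jr]; first by rewrite divff.
have [->|Fj0] := eqVneq (F j) 0; first by rewrite mul0r.
by case: nr; exists j.
Qed.

(** Divide by a term of least valuation: were all other terms of strictly
    larger valuation, -1 would lie in the maximal ideal. *)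
Lemma vanishing_sum_associate (I : finType) (F : I -> K) :
    (exists i, F i != 0) -> \sum_i F i = 0 ->
  exists i j, i != j /\ runit (F i / F j).
Proof.
move=> [k Fk0] sum0; have [|i [_ Fi0 Fi]] := exists_dominant (r := enum I) (F := F).
  by exists k; rewrite ?mem_enum.
apply: boolp.contrapT => nij.
have Nj : forall j, j != i -> nonunit (F j / F i).
  move=> j ji; split=> [|Sij]; first by apply: Fi; rewrite mem_enum.
  have [->|Fj0] := eqVneq (F j) 0; first by rewrite mul0r.
  case: nij; exists j, i; split=> //; split=> //.
    by rewrite mulf_neq0 ?invr_eq0.
  by apply: Fi; rewrite mem_enum.
have [_] := nonunit_sum (index_enum I) Nj; rewrite -mulr_suml.
have: \sum_(j | j != i) F j = - F i.
  by move: sum0; rewrite (bigD1 i) //= addrC => /eqP; rewrite addr_eq0 => /eqP.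
move=> ->; rewrite mulNr divff // invrN invr1 => /(_ (SN S1)) /eqP.
by rewrite oppr_eq0 oner_eq0.
Qed.

End ValuationRing.

Section ValuationFacts.
Variables (K : fieldType) (w : K -> int).
Hypothesis dw : discrete_valuation w.

Let wM := let: And3 wM _ _ := dw in wM.
Let wD := let: And3 _ wD _ := dw in wD.

Lemma dval1 : w 1 = 0.
Proof.
have := wM (oner_neq0 _) (oner_neq0 _).
by rewrite mulr1 -{1}[w 1]addr0 => /addrI.
Qed.

Lemma dvalV x : x != 0 -> w x^-1 = - w x.
Proof.
move=> x0; have := wM x0 (_ : x^-1 != 0); rewrite invr_eq0 divff // dval1.
by move=> /(_ x0)/esym/eqP; rewrite addrC addr_eq0 => /eqP.
Qed.

Lemma dvalX x i : x != 0 -> w (x ^+ i) = w x * i%:Z.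
Proof.
move=> x0; elim: i => [|i IHi]; first by rewrite expr0 dval1 mulr0.
by rewrite exprS wM ?expf_neq0 // IHi intS mulrDr mulr1.
Qed.

Lemma dvalXz x (z : int) : x != 0 -> w (x ^ z) = z * w x.
Proof.
move=> x0; case: z => i; first by rewrite [w _]dvalX // mulrC.
by rewrite NegzE -exprnN dvalV ?expf_neq0 // dvalX // mulrC mulNr.
Qed.

Lemma dvalN x : x != 0 -> w (- x) = w x.
Proof.
move=> x0; rewrite -mulN1r wM ?oppr_eq0 ?oner_neq0 //.
have := @dvalX (-1) 2 _; rewrite sqrrN expr1n dval1 oppr_eq0 oner_neq0.
by move=> /(_ isT)/esym/eqP; rewrite mulf_eq0 orbF => /eqP->; rewrite add0r.
Qed.

Definition dval_ring (x : K) := x = 0 \/ 0 <= w x.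

Lemma dval_ring1 : dval_ring 1.
Proof. by right; rewrite dval1. Qed.

Lemma dval_ringM x y : dval_ring x -> dval_ring y -> dval_ring (x * y).
Proof.
have [->|x0] := eqVneq x 0; first by left; rewrite mul0r.
have [->|y0] := eqVneq y 0; first by left; rewrite mulr0.
move=> [/eqP|wx]; first by rewrite (negPf x0).
move=> [/eqP|wy]; first by rewrite (negPf y0).
by right; rewrite wM // addr_ge0.
Qed.

Lemma dval_ringB x y : dval_ring x -> dval_ring y -> dval_ring (x - y).
Proof.
have [->|y0] := eqVneq y 0; first by rewrite subr0.
have [->|x0] := eqVneq x 0; first by rewrite sub0r /dval_ring dvalN // => _ [->|];
  [left; rewrite oppr0|right].
have [->|xy0] := eqVneq (x - y) 0; first by left.
move=> [/eqP|wx]; first by rewrite (negPf x0).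
move=> [/eqP|wy]; first by rewrite (negPf y0).
right; apply: le_trans (wD x0 _ xy0); rewrite ?oppr_eq0 // dvalN //.
by rewrite le_min wx wy.
Qed.

(** The ultrametric inequality is an equality when the valuations differ. *)
Lemma dval_dominant x y : x != 0 -> (y = 0 \/ w x < w y) ->
  x + y != 0 /\ w (x + y) = w x.
Proof.
move=> x0 [->|lt_xy]; first by rewrite addr0.
have [Dy|y0] := eqVneq y 0; first by rewrite Dy addr0.
have xy0 : x + y != 0.
  rewrite addr_eq0; apply: contraTneq lt_xy => ->.
  by rewrite dvalN // ltxx.
split=> //; apply/eqP; rewrite eq_le; apply/andP; split; last first.
  by apply: le_trans (wD x0 y0 xy0); rewrite le_min lexx ltW.
have := wD xy0 (_ : - y != 0); rewrite addrK oppr_eq0 dvalN // => /(_ y0 x0).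
by rewrite ge_min leNgt => /orP[|]; rewrite ?leNgt ?lt_xy // -leNgt.
Qed.

(** When w y < 0, the term y^q dominates y. *)
Lemma dval_artin_schreier q y : (1 < q)%N -> ~ dval_ring y ->
  y ^+ q - y != 0 /\ w (y ^+ q - y) = w y * q%:Z /\ w y < 0.
Proof.
move=> q1 ny; have y0 : y != 0 by apply/eqP => y0; apply: ny; left.
have wy : w y < 0 by rewrite ltNge; apply/negP => wy; apply: ny; right.
have [||nz Dw] := @dval_dominant (y ^+ q) (- y); first by rewrite expf_neq0.
  right; rewrite dvalN // dvalX // -[X in _ < X]mulr1 ltr_nM2l //.
by rewrite nz Dw dvalX.
Qed.

(** A special case of the integral closedness of valuation rings. *)
Lemma dval_ring_closed q y : (1 < q)%N -> dval_ring (y ^+ q - y) -> dval_ring y.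
Proof.
move=> q1 Sy; apply: boolp.contrapT => /(dval_artin_schreier q1)[nz [Dw wy]].
case: Sy => [/eqP|]; first by rewrite (negPf nz).
by rewrite Dw leNgt nmulr_rlt0 // ltz_nat ltnW.
Qed.

(** Since c and y^q - y differ by an integral element, y has a pole, and the
    pole of y^q - y, of order q times that of y, is the pole of c. *)
Lemma artin_schreier_pole q y c : (1 < q)%N -> c != 0 -> w c < 0 ->
  dval_ring (y ^+ q - y - c) -> w c = w y * q%:Z.
Proof.
move=> q1 c0 wc Sz; have ny : ~ dval_ring y.
  move=> Sy; have Syq : dval_ring (y ^+ q - y).
    by apply: dval_ringB => //; apply: (sringX dval_ring1 dval_ringM).
  have: dval_ring c by rewrite -[c](subKr (y ^+ q - y)); apply: dval_ringB.
  by case=> [/eqP|]; [rewrite (negPf c0) | rewrite leNgt wc].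
have [nz [Dw wy]] := dval_artin_schreier q1 ny.
have [|_] := @dval_dominant (y ^+ q - y) (- (y ^+ q - y - c)) nz.
  have [->|z0] := eqVneq (y ^+ q - y - c) 0; first by left; rewrite oppr0.
  right; rewrite dvalN //; case: Sz => [/eqP|]; first by rewrite (negPf z0).
  by apply: lt_le_trans; rewrite Dw nmulr_rlt0 // ltz_nat ltnW.
by rewrite subKr Dw.
Qed.

End ValuationFacts.

Section DiscreteValuation.
Variables (K : fieldType) (S : K -> Prop) (pi : K) (M : nat).
Hypotheses (S1 : S 1) (SB : forall a b, S a -> S b -> S (a - b)).
Hypotheses (SM : forall a b, S a -> S b -> S (a * b)).
Hypothesis Sval : forall x, S x \/ S x^-1.
Hypotheses (Spi : S pi) (Sni : ~ S pi^-1) (M_gt0 : (0 < M)%N).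
Hypothesis root_pi :
  forall x, x != 0 -> exists z : int, runit S (x ^+ M / pi ^ z).

Let SD := sringD S1 SB.
Let SX := sringX S1 SM.

Let pi_neq0 : pi != 0.
Proof. by apply: contra_not_neq Sni => ->; rewrite invr0; apply: sring0 SB. Qed.

Lemma pi_power_ge0 (z : int) : S (pi ^ z) -> 0 <= z.
Proof.
case: z => // n; rewrite NegzE -exprnN -exprVn => Sn; case: Sni.
have ->: pi^-1 = pi ^+ n * pi^-1 ^+ n.+1; last by apply: SM => //; apply: SX.
by rewrite exprSr mulrA -exprMn divff // expr1n mul1r.
Qed.

(** The hypothesis [root_pi] says that the value group of S is torsion, of
    exponent M, modulo the powers of pi.  So x |-> z, where x^M and pi^z are
    associate, is a valuation with integer values; dividing by the positive
    generator of its image makes it onto. *)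
Lemma exists_discrete_valuation :
  exists w : K -> int, [/\ discrete_valuation w,
    forall x, x != 0 -> (0 <= w x <-> S x) & 0 < w pi].
Proof.
have /boolp.choice[W WP] :
    forall x, exists z : int, x != 0 -> runit S (x ^+ M / pi ^ z).
  move=> x.
  have [->|x0] := eqVneq x 0; first by exists 0.
  by have [z Uz] := root_pi x0; exists z.
have piz z : pi ^ z != 0 by apply: expfz_neq0.
have Wuniq x z : x != 0 -> S (x ^+ M / pi ^ z) -> z <= W x.
  move=> x0 Sz; have [_ _ SW] := WP x x0; rewrite -subr_ge0.
  apply: pi_power_ge0; rewrite expfzDr // -invr_expz.
  by have := SM SW Sz; rewrite invf_div mulrA divfK ?expf_neq0.
have Wge0 x : x != 0 -> (0 <= W x) <-> S x.
  move=> x0; split=> [W0|Sx]; last first.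
    by apply: Wuniq => //; rewrite expr0z divr1; apply: SX.
  have [//|Sx'] := Sval x; suff: runit S (x ^+ M) by case/(runit_root S1 SM Sval).
  split; rewrite ?expf_neq0 -?exprVn //; last exact: SX.
  have [_ SW _] := WP x x0; have := SM SW (_ : S (pi ^ W x)).
  rewrite divfK //; apply; case: (W x) W0 => // n _; exact: SX.
have WM x y : x != 0 -> y != 0 -> W (x * y) = W x + W y.
  move=> x0 y0; have xy0 : x * y != 0 by rewrite mulf_neq0.
  have U : runit S ((x * y) ^+ M / pi ^ (W x + W y)).
    rewrite expfzDr // invfM exprMn mulrACA.
    by apply: runitM (WP x x0) (WP y y0).
  apply/eqP; rewrite eq_le Wuniq ?andbT //; last by case: U.
  have [_ SW _] := WP _ xy0; have [_ _ SU] := U.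
  rewrite -subr_ge0; apply: pi_power_ge0; rewrite expfzDr // -invr_expz.
  by have := SM SU SW; rewrite invf_div mulrA divfK ?expf_neq0.
have W1 : W 1 = 0.
  have := WM 1 1 (oner_neq0 _) (oner_neq0 _).
  by rewrite mulr1 -{1}[W 1]addr0 => /addrI.
have WV x : x != 0 -> W x^-1 = - W x.
  move=> x0; have := WM x x^-1 x0; rewrite invr_eq0 divff // W1 => /(_ x0)/esym/eqP.
  by rewrite addrC addr_eq0 => /eqP.
have WXz x z : x != 0 -> W (x ^ z) = z * W x.
  move=> x0; have WX n : W (x ^+ n) = n%:Z * W x.
    elim: n => [|n IHn]; first by rewrite expr0 W1 mul0r.
    by rewrite exprS WM ?expf_neq0 // IHn intS mulrDl mul1r.
  case: z => n; first exact: WX.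
  by rewrite NegzE -exprnN WV ?expf_neq0 // WX mulNr.
have Wpi : W pi = M.
  apply/eqP; rewrite eq_le Wuniq ?divff ?andbT //; last by rewrite expf_neq0.
  have [_ SW _] := WP _ pi_neq0; rewrite -subr_ge0.
  by apply: pi_power_ge0; rewrite expfzDr // -invr_expz.
(* the least positive value d = d0 + 1 generates the image of W *)
pose Q n := boolp.asbool (exists2 t, t != 0 & W t = n.+1).
have exQ : exists n, Q n.
  by exists M.-1; apply/boolp.asboolP; exists pi; rewrite // prednK.
case: (ex_minnP exQ) => d0 /boolp.asboolP[t t0 Wt] d_min.
pose d : int := d0.+1.
have dvW x : x != 0 -> (d %| W x)%Z.
  move=> x0; apply/dvdz_mod0P.
  have := divz_eq (W x) d; set r := (W x %% d)%Z => Dr.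
  have: 0 <= r < d by rewrite modz_ge0 //= ltz_pmod.
  case Er: r => [[|n]|//] /andP[_ lt_nd] //; case/negP: (ltnn d0).
  have/d_min : Q n.
    apply/boolp.asboolP; exists (x / t ^ (W x %/ d)%Z).
      by rewrite mulf_neq0 ?invr_eq0 ?expfz_neq0.
    rewrite WM ?invr_eq0 ?expfz_neq0 // WV ?expfz_neq0 // WXz // Wt.
    by rewrite -Er {1}Dr addrAC subrr add0r.
  by move/leq_ltn_trans; apply; rewrite ltz_nat ltnS in lt_nd.
pose w x := (W x %/ d)%Z.
have wE x : x != 0 -> W x = w x * d by move=> x0; rewrite divzK // dvW.
have d_gt0 : 0 < d by [].
have w_ge0 x : x != 0 -> (0 <= w x <-> S x).
  by move=> x0; rewrite -Wge0 // wE // pmulr_lge0.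
have wM x y : x != 0 -> y != 0 -> w (x * y) = w x + w y.
  by move=> x0 y0; rewrite /w WM // divzDl // dvW.
have wV x : x != 0 -> w x^-1 = - w x.
  move=> x0; apply: (@mulIf _ d) => //.
  by rewrite -wE ?invr_eq0 // WV // wE // mulNr.
exists w; split=> //; last by rewrite -(pmulr_lgt0 _ d_gt0) -wE // Wpi ltz_nat.
split=> // [a b|]; last by exists t; rewrite // /w Wt divzz.
wlog Sab : a b / S (a / b).
  move=> IH a0 b0; case: (Sval (a / b)) => [Sab|]; first exact: IH.
  by rewrite invf_div => Sba ab0; rewrite minC addrC IH // addrC.
move=> a0 b0 ab0; rewrite ge_min; apply/orP; right.
have Dab : a + b = b * (a / b + 1).
  by rewrite mulrDr mulr1 mulrCA divff ?mulr1.
have nz : a / b + 1 != 0 by apply: contraNneq ab0 => z; rewrite Dab z mulr0.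
by rewrite Dab wM // lerDl; apply/w_ge0 => //; apply: SD.
Qed.

End DiscreteValuation.

(** Let S be a maximal subring of K above O in which pi is not a unit.  An
    element x of K satisfies a polynomial relation over k of degree at most
    [K : k]; two of its terms are associate in S, so some power x^i, with
    0 < i <= [K : k], is associate to an element of k, that is to a power of
    pi.  A common exponent is a factorial. *)
Theorem extend_discrete_valuation (k : fieldType) (K : fieldExtType k)
    (O : k -> Prop) (pi : k) (v : k -> int) :
    O 1 -> (forall a b, O a -> O b -> O (a - b)) ->
    (forall a b, O a -> O b -> O (a * b)) -> O pi -> ~ O pi^-1 ->
    (forall c, c != 0 -> exists u, [/\ u != 0, O u, O u^-1 & c = pi ^ v c * u]) ->
  exists (w : K -> int) (e : nat),
    [/\ discrete_valuation w, (0 < e)%N,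
        forall c : k, c != 0 -> w c%:A = v c *+ e, w pi%:A = e
      & forall c : k, c != 0 -> O c -> 0 <= w c%:A].
Proof.
move=> O1 OB OM Opi Oni Ov.
have [f fE] : exists f : {rmorphism k -> K}, forall c, c%:A = f c.
  by exists (in_alg K).
pose OK x := exists2 c, O c & x = f c.
have [||||S [[S1 SB] SM SO Sni Smax]] := @exists_max_subring K (f pi) OK.
- by exists 1; rewrite ?rmorph1.
- by move=> _ _ [a Oa ->] [b Ob ->]; exists (a - b); [apply: OB|rewrite rmorphB].
- by move=> _ _ [a Oa ->] [b Ob ->]; exists (a * b); [apply: OM|rewrite rmorphM].
- by move=> [c Oc]; rewrite -fmorphV => /fmorph_inj Dc; apply: Oni; rewrite Dc.
have {}SO c : O c -> S (f c) by move=> Oc; apply: SO; exists c.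
have Spi : S (f pi) by apply: SO.
have Sval := max_subring_valuation S1 SB SM Spi Sni Smax.
have fU u : u != 0 -> O u -> O u^-1 -> runit S (f u).
  by move=> u0 Ou Ou'; split; rewrite ?fmorph_eq0 -?fmorphV //; apply: SO.
(* every positive integer up to [K : k] divides M *)
pose N := (\dim {:K}).+1; pose M := N`!.
have rootP x : x != 0 -> exists z : int, runit S (x ^+ M / f pi ^ z).
  move=> x0; pose P := minPoly 1%AS x.
  have P1 i : exists c, P`_i = f c.
    by have /vlineP[c ->] := polyOverP (minPolyOver 1%AS x) i; exists c.
  have szP : (size P <= N)%N.
    rewrite size_minPoly ltnS; have := dimvS (subvf <<1%AS; x>>%AS).
    by rewrite dim_Fadjoin dimv1 muln1.
  have sum0 : \sum_(i < size P) P`_i * x ^+ i = 0.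
    by rewrite -horner_coef; apply/rootP/root_minPoly.
  have ex0 : exists i : 'I_(size P), P`_i * x ^+ i != 0.
    have lt_s : ((size P).-1 < size P)%N.
      by rewrite prednK // size_minPoly.
    exists (Ordinal lt_s); rewrite mulf_neq0 ?expf_neq0 //= -lead_coefE.
    by rewrite (monicP (monic_minPoly 1%AS x)) oner_neq0.
  have [i [j [ij Uij]]] := vanishing_sum_associate S1 SB SM Sval ex0 sum0.
  wlog lt_ij : i j ij Uij / (j < i)%N.
    move=> IH; case: (ltngtP i j) => [||/val_inj/eqP]; last by rewrite (negPf ij).
    - move=> lt_ij; apply: (IH j i) => //; first by rewrite eq_sym.
      by rewrite -invf_div; apply: runitV.
    - exact: IH.
  have [c Dc] : exists c, P`_i / P`_j = f c.
    have [[a ->] [b ->]] := (P1 i, P1 j).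
    by exists (a / b); rewrite fmorph_div.
  have {}Uij : runit S (f c * x ^+ (i - j)).
    rewrite -Dc expfB // mulrACA -invfM; exact: Uij.
  have c0 : c != 0.
    case: Uij => + _ _; apply: contraNneq => ->.
    by rewrite rmorph0 mul0r.
  have [u [u0 Ou Ou' Dcu]] := Ov c c0.
  have dvM : (i - j %| M)%N.
    apply: dvdn_fact; rewrite subn_gt0 lt_ij /=.
    by apply: leq_trans (leq_subr _ _) _; apply: ltnW (leq_trans (ltn_ord i) szP).
  pose q := (M %/ (i - j))%N; exists (- (v c * q%:Z)).
  have -> : x ^+ M / f pi ^ (- (v c * q%:Z)) =
    ((f u)^-1 * (f c * x ^+ (i - j))) ^+ q.
    rewrite mulrA {2}Dcu rmorphM [_ * f u]mulrC mulKf ?fmorph_eq0 //.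
    rewrite exprMn -exprM [(_ * q)%N]mulnC divnK // mulrC; congr (_ * _).
    by rewrite -invr_expz invrK -exprz_exp fmorphXz.
  by apply/(runitX S1 SM)/runitM => //; apply/runitV/fU.
have [w [dw w_ge0 wpi]] := exists_discrete_valuation S1 SB SM Sval Spi Sni
  (fact_gt0 N) rootP.
have [wM _ _] := dw.
have pi0 : pi != 0.
  apply: contra_not_neq Oni => ->; rewrite invr0.
  by apply: sring0 O1 OB.
exists w, `|w (f pi)|%N; split=> // [|c c0||c c0 Oc]; rewrite ?fE.
- by rewrite absz_gt0 gt_eqF.
- have [u [u0 Ou Ou' Dc]] := Ov c c0; rewrite {1}Dc rmorphM /= fmorphXz //.
  rewrite wM ?expfz_neq0 ?fmorph_eq0 // (dvalXz dw) ?fmorph_eq0 //.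
  have ->: w (f u) = 0.
    have fu0 : f u != 0 by rewrite fmorph_eq0.
    apply/eqP; rewrite eq_le -oppr_ge0 -(dvalV dw) //.
    by apply/andP; split; apply/w_ge0; rewrite ?invr_eq0 -?fmorphV //; apply: SO.
  by rewrite addr0 -mulr_natr natz gez0_abs // ltW.
- by rewrite gez0_abs // ltW.
- by apply/w_ge0; rewrite ?fmorph_eq0 //; apply: SO.
Qed.

(** * The map x |-> x^q - x *)

Section Frobenius.
Variables (p n : nat) (R : comNzRingType).
Hypothesis char_p : p \in [pchar R].

Lemma expDq (a b : R) : (a + b) ^+ (p ^ n) = a ^+ (p ^ n) + b ^+ (p ^ n).
Proof.
apply: exprDn_pchar; rewrite pnatX pnatE ?char_p //.
exact: pcharf_prime char_p.
Qed.

Lemma expNq (a : R) : (- a) ^+ (p ^ n) = - a ^+ (p ^ n).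
Proof.
apply/eqP; rewrite -addr_eq0 -expDq addNr expr0n expn_eq0.
by rewrite (gtn_eqF (prime_gt0 (pcharf_prime char_p))).
Qed.

Lemma expBq (a b : R) : (a - b) ^+ (p ^ n) = a ^+ (p ^ n) - b ^+ (p ^ n).
Proof. by rewrite expDq expNq. Qed.

Definition artin_schreier (a : R) := a ^+ (p ^ n) - a.

Lemma artin_schreierD a b :
  artin_schreier (a + b) = artin_schreier a + artin_schreier b.
Proof. by rewrite /artin_schreier expDq opprD addrACA. Qed.

Lemma artin_schreierN a : artin_schreier (- a) = - artin_schreier a.
Proof. by rewrite /artin_schreier expNq opprB opprK addrC. Qed.

Lemma artin_schreier0 : artin_schreier 0 = 0.
Proof.
rewrite /artin_schreier expr0n expn_eq0.
by rewrite (gtn_eqF (prime_gt0 (pcharf_prime char_p))) subr0.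
Qed.

End Frobenius.

(** * Prime factors of polynomials *)

Section PolynomialPrimes.
Variable F : fieldType.
Implicit Types D f g : {poly F}.

Lemma irred_dvdpM D f g :
  irreducible_poly D -> D %| f * g -> (D %| f) || (D %| g).
Proof.
move=> [D1 irrD]; case: (boolP (D %| f)) => //= nDf Dfg.
rewrite -(@Gauss_dvdpr _ _ f) // coprimep_def.
apply: contraNT nDf => g1; have /(eqp_dvdl f) <- := irrD _ g1 (dvdp_gcdl D f).
exact: dvdp_gcdr.
Qed.

Lemma irred_dvdpX D f k : irreducible_poly D -> D %| f ^+ k -> D %| f.
Proof.
move=> irrD; elim: k => [|k IHk].
  by rewrite expr0 dvdp1 (gtn_eqF irrD.1).
by rewrite exprS => /(irred_dvdpM irrD)/orP[].
Qed.

Lemma irred_coprime D f : irreducible_poly D -> ~~ (D %| f) -> coprimep f D.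
Proof.
move=> [_ irrD]; rewrite coprimep_sym coprimep_def; apply: contraNT => g1.
by have /(eqp_dvdl f) <- := irrD _ g1 (dvdp_gcdl D f); apply: dvdp_gcdr.
Qed.

Lemma exists_prime_factor f : (1 < size f)%N ->
  exists D, [/\ D \is monic, irreducible_poly D & D %| f].
Proof.
have [N] := ubnP (size f); elim: N f => // N IHN f; rewrite ltnS => le_fN f1.
have f0 : f != 0 by rewrite -size_poly_gt0 ltnW.
have [irrf|nirr] := boolp.pselect (irreducible_poly f).
  have c0 : (lead_coef f)^-1 != 0 by rewrite invr_eq0 lead_coef_eq0.
  exists ((lead_coef f)^-1 *: f); split; last by rewrite dvdpZl.
    by rewrite monicE lead_coefZ mulVf // lead_coef_eq0.
  split=> [|g g1]; first by rewrite size_scale.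
  rewrite dvdpZr // => /(irrf.2 g g1) /eqp_trans; apply.
  by rewrite eqp_sym eqp_scale.
have [g [g1 gf ng]] : exists g, [/\ size g != 1, g %| f & ~ g %= f].
  apply: boolp.contrapT => ng; apply: nirr; split=> // g g1 gf.
  by apply: boolp.contrapT => nfg; apply: ng; exists g.
have g0 : g != 0 by apply: dvdpN0 gf _.
have lt_gf : (size g < size f)%N.
  rewrite ltn_neqAle dvdp_leq // andbT; apply/negP => sz.
  by apply: ng; rewrite -dvdp_size_eqp.
have [||D [mD irrD Dg]] := IHN g.
- exact: leq_trans le_fN.
- by rewrite ltn_neqAle eq_sym g1 size_poly_gt0.
by exists D; split=> //; apply: dvdp_trans gf.
Qed.

Lemma split_power D f : (1 < size D)%N -> f != 0 ->
  exists e g, f = D ^+ e * g /\ ~~ (D %| g).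
Proof.
move=> D1; have [N] := ubnP (size f); elim: N f => // N IHN f.
rewrite ltnS => le_fN f0; have [/dvdpP[g Df]|nDf] := boolP (D %| f); last first.
  by exists 0%N, f; rewrite expr0 mul1r.
have g0 : g != 0 by apply: contraNneq f0 => g0; rewrite Df g0 mul0r.
have D0 : D != 0 by rewrite -size_poly_gt0 ltnW.
have lt_gf : (size g < size f)%N.
  rewrite Df size_mul // -subn1 -addnBA ?subn1 ?(ltnW D1) //.
  by rewrite -[X in (X < _)%N]addn0 ltn_add2l -ltnS prednK // ltnW.
have [||e [h [Dg nDh]]] := IHN g; rewrite ?(leq_trans lt_gf) //.
by exists e.+1, h; rewrite exprS -mulrA -Dg mulrC.
Qed.

Lemma poly_mult_power D e g : irreducible_poly D -> g != 0 -> ~~ (D %| g) ->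
  poly_mult D (D ^+ e * g) = e.
Proof.
move=> irrD g0 nDg; have D1 := irrD.1; have D0 := irredp_neq0 irrD.
apply/eqP; rewrite eqn_leq; apply/andP; split.
  apply/bigmax_leqP => i; apply: contraTT; rewrite -ltnNge => lt_ei.
  rewrite -(subnK lt_ei) addnS -addSn addnC exprD dvdp_mul2l ?expf_neq0 //.
  by apply: contraNN nDg => /(dvdp_trans _); apply; rewrite exprS dvdp_mulr.
have lt_e : (e < size (D ^+ e * g)%R)%N.
  rewrite size_mul ?expf_neq0 // -(prednK (_ : 0 < size (D ^+ e))%N); last first.
    by rewrite size_poly_gt0 expf_neq0.
  rewrite size_exp addSn /= -[X in (X < _)%N]mul1n.
  apply: leq_ltn_trans (_ : (size D).-1 * e < _)%N.
    by rewrite leq_mul2r orbC -ltnS prednK ?D1 // ltnW.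
  by rewrite -[X in (X < _)%N]addn0 ltn_add2l size_poly_gt0.
by apply: (@leq_bigmax_cond _ _ (fun i : 'I_ _ => i : nat) (Ordinal lt_e));
  rewrite /= dvdp_mulr.
Qed.

End PolynomialPrimes.

Lemma tofrac_denom_mul (R : idomainType) (x : {fraction R}) :
  FracField.tofrac (frac (generic_quotient.repr x)).2 * x
    = FracField.tofrac (frac (generic_quotient.repr x)).1.
Proof.
rewrite -{2}[x]generic_quotient.reprK; set y := generic_quotient.repr x.
unlock FracField.tofrac; rewrite -[LHS]FracField.pi_mul.
apply/generic_quotient.eqmodP; rewrite /= FracField.equivfE /FracField.mulf.
rewrite !numden_Ratio ?mul1r ?mulf_neq0 ?oner_neq0 ?denom_ratioP //.
by rewrite mulr1 mulrC.
Qed.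

(** * Partial fractions modulo x^q - x *)

Section Reduced.
Variables (p n : nat) (F : fieldType).
Implicit Types D f : {poly F}.

(** f / D^e is a proper fraction, in lowest terms, whose pole order e is not
    divisible by p^n unless e = 0; in that case properness forces f = 0. *)
Definition pole_reduced D e f :=
  (size f < size (D ^+ e)%R)%N /\ ((0 < e)%N ->
    (exists lambda mu,
       [/\ e = (lambda * p ^ mu)%N, coprime lambda p & (mu < n)%N])
    /\ coprimep f D).

Definition degree_reduced f := (1 < size f)%N ->
  exists nu mu, [/\ (size f).-1 = (nu * p ^ mu)%N, coprime (p ^ n) nu & (mu < n)%N].

End Reduced.

Section PoleReduction.
Variables (p n : nat) (n_gt0 : (0 < n)%N) (k0 : finFieldType).
Hypothesis char_p : p \in [pchar k0].
Local Notation q := (p ^ n)%N.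
Local Notation k := {fraction {poly k0}}.
Implicit Types D f g : {poly k0}.

Let pr_p : prime p := pcharf_prime char_p.

Lemma char_polyk : p \in [pchar {poly k0}].
Proof. by rewrite pchar_poly. Qed.

Lemma char_frack : p \in [pchar k].
Proof. exact: (rmorph_pchar (@FracField.tofrac {poly k0}) char_polyk). Qed.

Lemma q_gt1 : (1 < q)%N.
Proof. by rewrite -(exp1n n) ltn_exp2r // prime_gt1. Qed.

Lemma nondvd_exponent e : (0 < e)%N -> ~~ (q %| e)%N ->
  exists lambda mu, [/\ e = (lambda * p ^ mu)%N, coprime lambda p & (mu < n)%N].
Proof.
move=> e_gt0; rewrite pfactor_dvdn // -ltnNge => lt_n.
have [l cop De] := pfactor_coprime pr_p e_gt0.
by exists l, (logn p e); rewrite coprime_sym.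
Qed.

(** Frobenius is injective on the residue field of D, which is finite: by the
    pigeonhole principle two iterates f^(q^i) and f^(q^j) agree modulo D, and
    injectivity gives f = f^(q^(j - i)) modulo D. *)
Lemma frob_surj_mod D f : irreducible_poly D -> exists g, D %| g ^+ q - f.
Proof.
move=> irrD; have D0 := irredp_neq0 irrD.
pose V := 'rV[k0]_(size D); pose N := #|{: V}|.
(* more exponents than residues modulo D *)
pose F (i : 'I_N.+1) : V := poly_rV ((f ^+ (q ^ i)) %% D).
have [i [j [ij eF]]] : exists i j : 'I_N.+1, i != j /\ F i = F j.
  have /injectivePn[i [j ij eF]] : ~~ injectiveb F.
    by apply/negP => /injectiveP/leq_card; rewrite card_ord ltnn.
  by exists i, j.
wlog lt_ij : i j ij eF / (i < j)%N.
  move=> IH; case: (ltngtP i j) => [||/val_inj/eqP]; last by rewrite (negPf ij).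
    exact: IH.
  by apply: (IH j i) => //; rewrite eq_sym.
have: D %| (f ^+ (q ^ (j - i)) - f) ^+ (q ^ i).
  have Dqi : (q ^ i = p ^ (n * i))%N by rewrite expnM.
  rewrite Dqi (expBq (n * i) char_polyk) -Dqi -exprM -expnD.
  rewrite subnK ?(ltnW lt_ij) //; have := congr1 (@rVpoly _ _) eF.
  rewrite !poly_rV_K ?(ltnW (ltn_modpN0 _ D0)) // => em.
  by rewrite /dvdp modpD modpN em subrr.
move/(irred_dvdpX irrD) => Dfq; exists (f ^+ (q ^ (j - i).-1)).
by rewrite -exprM -expnSr prednK // subn_gt0.
Qed.

Local Notation tf := (@FracField.tofrac {poly k0}).
Local Notation AS := (artin_schreier p n).

(** If q divides the pole order e, write f = r^q modulo D; subtracting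
    a^q - a with a = r / D^(e / q) lowers the order.  A fraction that is not
    proper contributes a polynomial. *)
Lemma normalize_pole D e f : irreducible_poly D ->
  exists (a : k) (e' : nat) (f' g : {poly k0}),
    tf f / tf (D ^+ e) + AS a = tf f' / tf (D ^+ e') + tf g /\
    pole_reduced p n D e' f'.
Proof.
move=> irrD; have D0 := irredp_neq0 irrD.
have tD0 i : tf (D ^+ i) != 0 by rewrite tofrac_eq0 expf_neq0.
elim: e f => [|e IHe] f.
  exists 0, 0%N, 0, f; rewrite (artin_schreier0 n char_frack) addr0 expr0 rmorph1 rmorph0.
  by rewrite !divr1 add0r; split=> //; split; rewrite // size_poly0 size_poly1.
have tDS : tf (D ^+ e.+1) = tf D * tf (D ^+ e) by rewrite exprS rmorphM.
have tDD0 : tf D != 0 by rewrite tofrac_eq0.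
have dropD u : tf (u * D) / tf (D ^+ e.+1) = tf u / tf (D ^+ e).
  by rewrite tDS rmorphM invfM -mulrA mulVKf.
pose u := f %% D ^+ e.+1; pose h := f %/ D ^+ e.+1.
have Df : tf f / tf (D ^+ e.+1) = tf u / tf (D ^+ e.+1) + tf h.
  have := tD0 e.+1; rewrite /u /h; move: (D ^+ e.+1) => P tP0.
  rewrite [in LHS](divp_eq f P).
  by rewrite rmorphD rmorphM mulrDl (mulfK tP0) addrC.
have [/dvdpP[w Dw]|nDu] := boolP (D %| u).
  have [a [e' [f' [g [Ea red]]]]] := IHe w.
  exists a, e', f', (g + h); split=> //.
  by rewrite Df Dw dropD addrAC Ea rmorphD addrA.
have [/dvdnP[e' De]|nqe] := boolP (q %| e.+1)%N; last first.
  exists 0, e.+1, u, h; rewrite Df (artin_schreier0 n char_frack) addr0; split=> //.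
  split; first by rewrite ltn_modp expf_neq0.
  by move=> _; split; [apply: nondvd_exponent | apply: irred_coprime].
have [r /dvdpP[w Dw]] := frob_surj_mod u irrD.
have e'_gt0 : (0 < e')%N by case: e' De.
have le_e' : (e' <= e)%N.
  by rewrite -ltnS De -[X in (X < _)%N]muln1 ltn_pmul2l // q_gt1.
have [a [e2 [f' [g [Ea red]]]]] := IHe (r * D ^+ (e - e') - w).
exists (a - tf r / tf (D ^+ e')), e2, f', (g + h); split=> //.
rewrite [in RHS]rmorphD [in RHS]addrA -Ea Df.
rewrite (artin_schreierD n char_frack) (artin_schreierN n char_frack).
have -> : tf u = tf (r ^+ q) - tf (w * D) by rewrite -Dw rmorphB opprB addrC subrK.
rewrite mulrBl dropD rmorphB mulrBl rmorphM.
have -> : tf r * tf (D ^+ (e - e')) / tf (D ^+ e) = tf r / tf (D ^+ e').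
  have -> : tf (D ^+ e) = tf (D ^+ (e - e')) * tf (D ^+ e').
    by rewrite -rmorphM -exprD subnK.
  by rewrite invfM -mulrA (mulVKf (tD0 _)).
have -> : tf (r ^+ q) / tf (D ^+ e.+1) = (tf r / tf (D ^+ e')) ^+ q.
  by rewrite De exprM !rmorphXn expr_div_n.
by rewrite /artin_schreier; ring.
Qed.

(** The analogue at infinity: a leading term b^q T^(q d) is traded for
    b T^d. *)
Lemma normalize_degree f :
  exists a g : {poly k0}, f + AS a = g /\ degree_reduced p n g.
Proof.
have [N] := ubnP (size f); elim: N f => // N IHN f; rewrite ltnS => le_fN.
have [lt1f|le_f1] := ltnP 1 (size f); last first.
  exists 0, f; rewrite (artin_schreier0 n char_polyk) addr0; split=> //.
  by rewrite /degree_reduced ltnNge le_f1.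
have d_gt0 : (0 < (size f).-1)%N by rewrite -ltnS prednK // ltnW.
have [/dvdnP[d Dd]|nqd] := boolP (q %| (size f).-1)%N; last first.
  exists 0, f; rewrite (artin_schreier0 n char_polyk) addr0; split=> // _.
  have [nu [mu [-> cop lt_mu]]] := nondvd_exponent d_gt0 nqd.
  by exists nu, mu; split=> //; rewrite coprimeXl // coprime_sym.
have dgt0 : (0 < d)%N by move: d_gt0; rewrite Dd muln_gt0 => /andP[].
have [b Db] : exists b, b ^+ q = lead_coef f.
  have injF : injective (fun x : k0 => x ^+ q).
    move=> x y /eqP; rewrite -subr_eq0 -(expBq n char_p) expf_eq0.
    by rewrite subr_eq0 => /andP[_ /eqP].
  by have [F' _ F'K] := injF_bij injF; exists (F' (lead_coef f)).
pose t : {poly k0} := b *: 'X^d.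
have lt_t : (size t < size f)%N.
  apply: leq_ltn_trans (size_scale_leq _ _) _; rewrite size_polyXn.
  rewrite -(prednK (ltnW lt1f)) ltnS Dd -[X in (X < _)%N]muln1.
  by rewrite ltn_pmul2l // q_gt1.
have lt_f : (size (f - t ^+ q)%R < size f)%N.
  have -> : t ^+ q = lead_coef f *: 'X^((size f).-1).
    by rewrite exprZn Db -exprM -Dd.
  rewrite -[X in (_ < X)%N](prednK (ltnW lt1f)) ltnS; apply/leq_sizeP => i.
  rewrite leq_eqVlt => /predU1P[<-|lt_i].
    by rewrite coefB coefZ coefXn eqxx mulr1 lead_coefE subrr.
  rewrite coefB coefZ coefXn gtn_eqF // mulr0 subr0 nth_default //.
  by rewrite -(prednK (ltnW lt1f)).
have [|a [g [Ea red]]] := IHN (f - t ^+ q + t).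
  apply: leq_ltn_trans (size_polyD _ _) _; rewrite gtn_max.
  by rewrite (leq_trans lt_f le_fN) (leq_trans lt_t le_fN).
exists (a - t), g; split=> //.
rewrite -Ea (artin_schreierD n char_polyk) (artin_schreierN n char_polyk).
by rewrite /artin_schreier; ring.
Qed.

(** Induction on the degree of M, splitting off the full power of a prime factor
    D by Bezout.  That the primes in s divide M ensures that D has not been
    used before. *)
Lemma partial_fractions f M : M != 0 ->
  exists (a : k) (s : seq {poly k0}) (e : {poly k0} -> nat)
         (Q : {poly k0} -> {poly k0}) (g : {poly k0}),
    [/\ uniq s,
        forall D, D \in s -> [/\ D \is monic, irreducible_poly D & D %| M],
        forall D, pole_reduced p n D (e D) (Q D), forall D, D \notin s -> Q D = 0
      & tf f / tf M + AS a = \sum_(D <- s) tf (Q D) / tf (D ^+ e D) + tf g].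
Proof.
have [N] := ubnP (size M); elim: N M f => // N IHN M f.
rewrite ltnS => le_MN M0; have [lt1M|le_M1] := ltnP 1 (size M); last first.
  have /size_poly1P[c c0 ->] : size M == 1.
    by rewrite eqn_leq le_M1 size_poly_gt0.
  exists 0, [::], (fun=> 0%N), (fun=> 0), (c^-1 *: f); split=> //.
    by move=> D; split=> //; rewrite size_poly0 size_poly1.
  rewrite big_nil add0r (artin_schreier0 n char_frack) addr0 -mul_polyC rmorphM /=.
  have c0F : tf c%:P != 0 by rewrite tofrac_eq0 polyC_eq0.
  apply: (canLR (mulfK c0F)).
  by rewrite mulrAC -rmorphM -polyCM (mulVf c0) rmorph1 mul1r.
have [D [mD irrD DM]] := exists_prime_factor lt1M.
have [e [M' [DefM nDM']]] := split_power irrD.1 M0.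
have M'0 : M' != 0 by apply: contraNneq nDM' => ->; apply: dvdp0.
have De0 : D ^+ e != 0 by rewrite expf_neq0 ?irredp_neq0.
have e_gt0 : (0 < e)%N.
  by case: e DefM {De0} => // DefM; move: nDM'; rewrite -[M']mul1r -DefM DM.
have /Bezout_eq1_coprimepP[[u v] /= Duv] : coprimep M' (D ^+ e).
  by apply/coprimep_expr/irred_coprime.
have lt_M' : (size M' < size M)%N.
  rewrite DefM size_mul // -(prednK (_ : 0 < size (D ^+ e)%R)%N) ?size_poly_gt0 //.
  rewrite addSn /= -[X in (X < _)%N]add0n ltn_add2r size_exp muln_gt0 e_gt0.
  by rewrite -ltnS prednK ?irrD.1 // ltnW ?irrD.1.
have [|//|a [s [eM [Q [g [us sP redQ Q0 Ea]]]]]] := IHN M' (f * v).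
  exact: leq_trans lt_M' le_MN.
have [a' [eD [fD [gD [Ea' redD]]]]] := normalize_pole e (f * u) irrD.
have Ds : D \notin s by apply/negP => /sP[_ _]; rewrite (negPf nDM').
pose e' D' := if D' == D then eD else eM D'.
pose Q' D' := if D' == D then fD else Q D'.
exists (a' + a), (D :: s), e', Q', (gD + g); split=> //.
- by rewrite /= Ds.
- move=> D'; rewrite inE => /predU1P[->//|/sP[mD' irrD' D'M']]; split=> //.
  by rewrite DefM dvdp_mull.
- by move=> D'; rewrite /e' /Q'; case: eqVneq => // ->.
- by move=> D'; rewrite inE negb_or /Q' => /andP[/negPf-> /Q0].
have -> : tf f / tf M = tf (f * u) / tf (D ^+ e) + tf (f * v) / tf M'.
  have [tD0 tM0] : tf (D ^+ e) != 0 /\ tf M' != 0 by rewrite !tofrac_eq0.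
  rewrite DefM (addf_div _ _ tD0 tM0) -!rmorphM -rmorphD; congr (tf _ / tf _).
  by rewrite -!mulrA -mulrDr Duv mulr1.
have -> : \sum_(D' <- D :: s) tf (Q' D') / tf (D' ^+ e' D') =
    tf fD / tf (D ^+ eD) + \sum_(D' <- s) tf (Q D') / tf (D' ^+ eM D').
  rewrite big_cons /e' /Q' eqxx; congr (_ + _); apply: eq_big_seq => D' sD'.
  by case: eqVneq => // eD'; rewrite -eD' sD' in Ds.
rewrite (artin_schreierD n char_frack) [in RHS]rmorphD [LHS]addrACA Ea Ea'.
exact: addrACA.
Qed.

End PoleReduction.

(** * Poles at unramified primes *)

Section LocalRing.
Variables (F : fieldType) (D : {poly F}).
Hypothesis irrD : irreducible_poly D.
Local Notation k := {fraction {poly F}}.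
Local Notation tf := (@FracField.tofrac {poly F}).

(** The localization of F[T] at D. *)
Definition local_ring (c : k) := exists a b, ~~ (D %| b) /\ c = tf a / tf b.

Let ndvd_neq0 b : ~~ (D %| b) -> tf b != 0.
Proof.
by move=> nDb; rewrite tofrac_eq0; apply: contraNneq nDb => ->; apply: dvdp0.
Qed.

Let ndvdM a b : ~~ (D %| a) -> ~~ (D %| b) -> ~~ (D %| a * b).
Proof.
by move=> nDa nDb; apply/negP => /(irred_dvdpM irrD); rewrite (negPf nDa) (negPf nDb).
Qed.

Let ndvd1 : ~~ (D %| 1).
Proof. by rewrite dvdp1 (gtn_eqF irrD.1). Qed.

Lemma local_ring_poly a : local_ring (tf a).
Proof. by exists a, 1; rewrite rmorph1 divr1. Qed.

Lemma local_ring1 : local_ring 1.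
Proof. by rewrite -(rmorph1 tf); apply: local_ring_poly. Qed.

Lemma local_ringB x y : local_ring x -> local_ring y -> local_ring (x - y).
Proof.
move=> [a [b [nb ->]]] [c [d [nd ->]]].
exists (a * d - c * b), (b * d); split; first exact: ndvdM.
rewrite -mulNr addf_div ?ndvd_neq0 // mulNr.
by rewrite rmorphB !rmorphM.
Qed.

Lemma local_ringM x y : local_ring x -> local_ring y -> local_ring (x * y).
Proof.
move=> [a [b [nb ->]]] [c [d [nd ->]]].
exists (a * c), (b * d); split; first exact: ndvdM.
by rewrite mulf_div !rmorphM.
Qed.

Lemma local_ringV : ~ local_ring (tf D)^-1.
Proof.
move=> [a [b [nb Dab]]]; have D0 := irredp_neq0 irrD.
have tD0 : tf D != 0 by rewrite tofrac_eq0.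
suff Db : b = a * D by move: nb; rewrite Db dvdp_mull.
apply/eqP; rewrite -tofrac_eq rmorphM.
move/(congr1 (fun z => z * tf b * tf D)): Dab.
by rewrite divfK ?ndvd_neq0 // mulrAC mulVf // mul1r => ->.
Qed.

Lemma local_ring_frac a b : ~~ (D %| b) -> local_ring (tf a / tf b).
Proof. by move=> nb; exists a, b. Qed.

(** [prime_val] is the D-adic valuation: writing an element as a power of D
    times a unit is all that the extension theorem asks of it. *)
Lemma prime_valE c : c != 0 ->
  exists u, [/\ u != 0, local_ring u, local_ring u^-1
    & c = tf D ^ (prime_val D c) * u].
Proof.
move=> c0; have [Dc d0] := (tofrac_denom_mul c, denom_ratioP (generic_quotient.repr c)).
rewrite -/(numer c) -/(denom c) in Dc d0; have D0 := irredp_neq0 irrD.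
have n0 : numer c != 0 by rewrite -tofrac_eq0 -Dc mulf_neq0 ?tofrac_eq0.
have [i [a [Ea nDa]]] := split_power irrD.1 n0.
have [j [b [Eb nDb]]] := split_power irrD.1 d0.
have [a0 b0] : a != 0 /\ b != 0.
  by split; [apply: contraNneq nDa | apply: contraNneq nDb] => ->; apply: dvdp0.
exists (tf a / tf b); split.
- by rewrite mulf_neq0 ?invr_eq0 ?tofrac_eq0.
- exact: local_ring_frac.
- by rewrite invf_div; apply: local_ring_frac.
have tD0 : tf D != 0 by rewrite tofrac_eq0.
have Dv : prime_val D c = i%:Z - j%:Z.
  by rewrite /prime_val Ea Eb !poly_mult_power.
rewrite {}Dv; have -> : c = tf (numer c) / tf (denom c).
  by rewrite -Dc mulrC mulKf ?tofrac_eq0.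
rewrite Ea Eb (expfzDr _ _ tD0) -invr_expz.
by rewrite !rmorphM !rmorphXn -mulf_div.
Qed.

End LocalRing.

Section Unramified.
Variables (F : fieldType) (D : {poly F}).
Hypothesis irrD : irreducible_poly D.
Local Notation k := {fraction {poly F}}.
Local Notation tf := (@FracField.tofrac {poly F}).
Variable K : fieldExtType k.

(** Any valuation produced by the extension theorem with e > 1 would witness
    ramification. *)
Lemma unramified_valuation : ~ ramified K (prime_val D) ->
  exists w : K -> int, [/\ discrete_valuation w,
    w (tf D)%:A = 1
    & forall c : k, c != 0 -> local_ring D c -> 0 <= w c%:A].
Proof.
move=> nram; have [||||||w [e [dw e_gt0 we wD w_ge0]]] :=
  @extend_discrete_valuation k K (local_ring D) (tf D) (prime_val D).
- exact: local_ring1.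
- exact: local_ringB.
- exact: local_ringM.
- exact: local_ring_poly.
- exact: local_ringV.
- exact: prime_valE.
have e1 : e = 1%N.
  case: e e_gt0 we wD => [|[|e]] // _ we; case: nram; exists w, e.+2; split=> //.
by exists w; split; rewrite ?wD ?e1.
Qed.

End Unramified.

Section UnramifiedPole.
Variables (p n : nat) (pr_p : prime p) (n_gt0 : (0 < n)%N) (F : fieldType).
Variables (D : {poly F}) (irrD : irreducible_poly D).
Local Notation k := {fraction {poly F}}.
Local Notation tf := (@FracField.tofrac {poly F}).
Variable K : fieldExtType k.
Variable w : K -> int.
Hypotheses (dw : discrete_valuation w) (wD : w (tf D)%:A = 1).
Hypothesis w_ge0 : forall c : k, c != 0 -> local_ring D c -> 0 <= w c%:A.

Lemma dval_pole e f : coprimep f D -> w (tf f / tf (D ^+ e))%:A = - e%:Z.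
Proof.
move=> cop; have [wM _ _] := dw.
have nDf : ~~ (D %| f).
  apply/negP => /coprimep_dvdr/(_ cop); rewrite coprimepp.
  by rewrite (gtn_eqF irrD.1).
have f0 : tf f != 0 by rewrite tofrac_eq0; apply: contraNneq nDf => ->; apply: dvdp0.
have D0 : tf D != 0 by rewrite tofrac_eq0 irredp_neq0.
pose A := in_alg K.
have A0 (c : k) : c != 0 -> A c != 0 by move=> c0; rewrite fmorph_eq0.
have wf : w (A (tf f)) = 0.
  apply/eqP; rewrite eq_le; apply/andP; split; last first.
    exact: w_ge0 f0 (local_ring_poly irrD f).
  rewrite -oppr_ge0 -(dvalV dw (A0 _ f0)) -fmorphV.
  have fV0 := invr_neq0 f0.
  have Of : local_ring D (tf f)^-1.
    by have := local_ring_frac 1 nDf; rewrite rmorph1 mul1r.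
  exact: w_ge0 fV0 Of.
have -> : (tf f / tf (D ^+ e))%:A = A (tf f) * (A (tf D) ^+ e)^-1.
  by rewrite -[LHS]/(in_alg K _) rmorphM fmorphV !rmorphXn.
have De0 : A (tf D) ^+ e != 0 by rewrite (expf_neq0 _ (A0 _ D0)).
have De0' : (A (tf D) ^+ e)^-1 != 0 by rewrite invr_eq0.
rewrite (wM _ _ (A0 _ f0) De0') wf add0r (dvalV dw De0) (dvalX dw _ (A0 _ D0)).
by rewrite [w (A _)]wD mul1r.
Qed.

(** If f were nonzero, then e > 0, the pole order of f / D^e would be e, and
    [artin_schreier_pole] would make it a multiple of q. *)
Lemma no_unramified_pole e f y : pole_reduced p n D e f ->
  dval_ring w (y ^+ (p ^ n) - y - (tf f / tf (D ^+ e))%:A) -> f = 0.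
Proof.
case: (posnP e) => [->|e_gt0] [lt_f red] Sy.
  by move: lt_f; rewrite expr0 size_poly1 ltnS leqn0 size_poly_eq0 => /eqP.
have [[l [mu [De copl lt_mu]]] copf] := red e_gt0.
have wc := dval_pole e copf.
have q1 : (1 < p ^ n)%N by rewrite -(exp1n n) ltn_exp2r // prime_gt1.
have [//|f0] := eqVneq f 0.
have c0 : ((tf f / tf (D ^+ e))%:A : K) != 0.
  rewrite -[_%:A]/(in_alg K _) fmorph_eq0 mulf_neq0 ?invr_eq0 ?tofrac_eq0 //.
  by rewrite expf_neq0 ?irredp_neq0.
have := artin_schreier_pole dw q1 c0 _ Sy; rewrite wc oppr_lt0 ltz_nat e_gt0.
move=> /(_ isT) /(congr1 absz); rewrite abszN abszM !absz_nat De => Dpn.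
have : (p ^ n %| l * p ^ mu)%N by rewrite Dpn dvdn_mull.
rewrite Gauss_dvdr; last by rewrite coprimeXl // coprime_sym.
by rewrite dvdn_Pexp2l ?prime_gt1 // leqNgt lt_mu.
Qed.

End UnramifiedPole.

(** * Additive Hilbert 90 for Witt vectors *)

Section WittExtra.
Variables (p : nat) (pr_p : prime p) (m : nat).

Lemma exists_frobenius (R : comNzRingType) n : p \in [pchar R] ->
  exists phi : {rmorphism R -> R}, forall x, phi x = x ^+ (p ^ n).
Proof.
move=> char_p; elim: n => [|n [phi phiE]]; first by exists idfun.
exists (pFrobenius_aut char_p \o phi) => x /=.
by rewrite pFrobenius_autE phiE -exprM expnSr.
Qed.

Lemma wcoef_pow (R : nzSemiRingType) i (x : witt pr_p m R) k : (i < m)%N ->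
  wcoef (witt_pow k x) i = wcoef x i ^+ k.
Proof. by move=> lt_im; rewrite /wcoef /witt_seq /= (nth_map 0) ?size_tuple. Qed.

Lemma witt_powD (R : comNzRingType) n (x y : witt pr_p m R) :
  p \in [pchar R] ->
  witt_pow (p ^ n) (x + y) = witt_pow (p ^ n) x + witt_pow (p ^ n) y.
Proof.
move=> /(exists_frobenius n)[phi phiE].
have powE (z : witt pr_p m R) : witt_pow (p ^ n) z = witt_map phi z.
  exact: eq_witt_map.
by rewrite !powE raddfD.
Qed.

Lemma wcoefD_single (R : comNzRingType) j (x : witt pr_p m R) a i :
    (forall l, (j <= l)%N -> wcoef x l = 0) -> (i < m)%N ->
  wcoef (x + wsingle pr_p m j a) i = if i == j then a else wcoef x i.
Proof.
move=> x0 lt_im; have ->: x = wtrunc j x.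
  by apply: wcoefP => l _; rewrite wcoef_trunc; case: ltnP => // /x0.
rewrite wcoefD_glue; last exact: wfil_single.
rewrite wcoef_single // wcoef_trunc; case: (ltngtP i j) => // lt_ji.
Qed.

End WittExtra.

Section GaloisCohomology.
Variables (F : fieldType) (K : splittingFieldType F) (U : {vspace K}).
Local Notation G := 'Gal({:K} / U)%g.

Lemma gal_mulE (x y : gal_of {:K}) a : (x * y)%g a = y (x a).
Proof. by rewrite galM ?memvf. Qed.

(** Take t of nonzero trace T, by independence of automorphisms; then
    b = - T^-1 sum_x c(x) x(t) works. *)
Lemma additive_Hilbert_90 (c : gal_of {:K} -> K) :
    {in G &, forall x y, c (x * y)%g = y (c x) + c y} ->
  exists b, {in G, forall x, c x = x b - b}.
Proof.
move=> cM.
have [t _ T0] := @gal_independent_contra _ _ {:K} (fun x => x \in G) (fun=> 1) 1%g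
  (group1 _) (oner_neq0 _).
pose T := \sum_(x in G) x t; have {}T0 : T != 0.
  by rewrite /T (eq_bigr (fun x : gal_of {:K} => 1 * x t)) // => x _; rewrite mul1r.
pose b := - T^-1 * \sum_(x in G) c x * x t.
have shift (E : gal_of {:K} -> K) y : y \in G ->
    \sum_(x in G) E (x * y)%g = \sum_(x in G) E x.
  move=> Gy; rewrite [RHS](reindex_inj (mulIg y)) /=.
  by apply: eq_bigl => x; rewrite groupMr.
exists b => y Gy; have yT : y T = T.
  rewrite rmorph_sum -[RHS](shift _ y Gy); apply: eq_bigr => x _.
  by rewrite gal_mulE.
rewrite /b rmorphM rmorphN fmorphV /= yT rmorph_sum -mulrBr.
have -> : \sum_(x in G) y (c x * x t) =
    \sum_(x in G) c x * x t - c y * T.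
  rewrite -[X in _ = X - _](shift _ y Gy) -yT rmorph_sum mulr_sumr -sumrB.
  apply: eq_bigr => x Gx; rewrite rmorphM cM // gal_mulE /=.
  by rewrite mulrDl addrK.
by rewrite addrAC subrr add0r mulrN mulNr opprK mulrCA mulVf // mulr1.
Qed.

Variables (p : nat) (pr_p : prime p) (m : nat).

(** Successive approximation along the filtration: if c minus the coboundary
    of b vanishes before position j, its entry j is an additive cocycle, hence
    a coboundary, and b can be corrected in position j. *)
Lemma witt_Hilbert_90 (c : gal_of {:K} -> witt pr_p m K) :
    {in G &, forall x y, c (x * y)%g = witt_map y (c x) + c y} ->
  exists b : witt pr_p m K, {in G, forall x, c x = witt_map x b - b}.
Proof.
move=> cM; suff [b fb] : exists b : witt pr_p m K,
    {in G, forall x, wfil m (c x - (witt_map x b - b))}.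
  by exists b => x Gx; apply/eqP; rewrite -subr_eq0; apply/eqP/wfil_full/fb.
suff: forall j, exists b : witt pr_p m K,
    {in G, forall x, wfil j (c x - (witt_map x b - b))} by apply.
elim=> [|j [b fb]]; first by exists 0.
pose d x := c x - (witt_map x b - b).
have dM : {in G &, forall x y, d (x * y)%g = witt_map y (d x) + d y}.
  move=> x y Gx Gy; rewrite /d cM // !raddfB /= witt_map_comp.
  have -> : witt_map (x * y)%g b = witt_map (y \o x) b.
    by apply: eq_witt_map => a; rewrite gal_mulE.
  move: (witt_map y (c x)) (witt_map (y \o x) b) (witt_map y b) => u v z.
  by ring.
have [|a ha] := @additive_Hilbert_90 (fun x => wcoef (d x) j).
  move=> x y Gx Gy; rewrite dM // wcoefD_lead; [|move=> i lt_ij|exact: fb].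
    by rewrite wcoef_map.
  by rewrite wcoef_map [wcoef _ _](fb x Gx i lt_ij) raddf0.
exists (b + wsingle pr_p m j a) => x Gx.
have -> : c x - (witt_map x (b + wsingle pr_p m j a) - (b + wsingle pr_p m j a))
    = d x - (wsingle pr_p m j (x a) - wsingle pr_p m j a).
  rewrite [witt_map x (_ + _)]raddfD /= map_wsingle /d.
  move: (c x) (witt_map x b) (wsingle _ _ _ _) (wsingle _ _ _ _) => u v z t.
  by ring.
have fs : wfil j (wsingle pr_p m j (x a) - wsingle pr_p m j a).
  by apply: wfilB; apply: wfil_single.
apply: wfilS; first exact: wfilB (fb x Gx) fs.
have [lt_jm|le_mj] := ltnP j m; last by rewrite wcoef_ge.
have sE : wcoef (wsingle pr_p m j (x a) - wsingle pr_p m j a) j = x a - a.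
  rewrite (wcoefB_lead (wfil_single _ _ _) (wfil_single _ _ _)).
  by rewrite !wcoef_single // eqxx.
by rewrite (wcoefB_lead (fb x Gx) fs) sE [wcoef _ _](ha x Gx) subrr.
Qed.

End GaloisCohomology.

Lemma eq_sum_uniq (T : eqType) (V : nmodType) (s1 s2 : seq T) (E : T -> V) :
    uniq s1 -> uniq s2 ->
    (forall x, x \in s1 -> x \notin s2 -> E x = 0) ->
    (forall x, x \in s2 -> x \notin s1 -> E x = 0) ->
  \sum_(x <- s1) E x = \sum_(x <- s2) E x.
Proof.
move=> us1 us2 E1 E2.
have cut (r r' : seq T) : (forall x, x \in r -> x \notin r' -> E x = 0) ->
    \sum_(x <- r) E x = \sum_(x <- r | x \in r') E x.
  move=> Er; rewrite [RHS]big_mkcond; apply: eq_big_seq => x rx.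
  by case: ifPn => // /Er->.
rewrite (cut s1 s2 E1) (cut s2 s1 E2) -big_filter -[RHS]big_filter; apply: perm_big.
apply: uniq_perm; rewrite ?filter_uniq // => x.
by rewrite !mem_filter andbC.
Qed.

(** * Normalization of the defining Witt vector *)

Section UnramifiedWitt.
Variables (p n m : nat) (pr_p : prime p) (n_gt0 : (0 < n)%N) (F : fieldType).
Variables (D : {poly F}) (irrD : irreducible_poly D).
Local Notation k := {fraction {poly F}}.
Local Notation tf := (@FracField.tofrac {poly F}).
Variable K : fieldExtType k.
Local Notation A := (in_alg K).
Hypothesis unramD : ~ ramified K (prime_val D).

(** Modulo the valuation ring, the entry l of F(y) - y = b reads
    y_l^q - y_l = b_l as soon as the earlier entries of y and b are integral.
    This gives integrality of the y_l for l < j one after the other, and then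
    the result for a single Artin-Schreier equation at l = j. *)
Lemma no_unramified_witt_pole (y : witt pr_p m K) (b : witt pr_p m k) j e f :
    (j < m)%N -> witt_pow (p ^ n) y - y = witt_map (in_alg K) b ->
    (forall i, (i < j)%N -> local_ring D (wcoef b i)) ->
    local_ring D (wcoef b j - tf f / tf (D ^+ e)) ->
    pole_reduced p n D e f ->
  f = 0.
Proof.
move=> lt_jm Dy Ob Oj red.
have [w [dw wD w_ge0]] := unramified_valuation irrD unramD.
have q1 : (1 < p ^ n)%N by rewrite -(exp1n n) ltn_exp2r // prime_gt1.
have S1 := dval_ring1 dw; have SB := dval_ringB dw; have SM := dval_ringM dw.
have SA c : local_ring D c -> dval_ring w (A c).
  have [->|c0] := eqVneq c 0; first by left; rewrite rmorph0.
  by move=> Oc; right; apply: w_ge0.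
have Sstep l : (l < m)%N -> (forall i, (i < l)%N -> dval_ring w (wcoef y i)) ->
    (forall i, (i < l)%N -> local_ring D (wcoef b i)) ->
    dval_ring w (wcoef y l ^+ (p ^ n) - wcoef y l - A (wcoef b l)).
  move=> lt_lm Sy Obl.
  have := @wcoefD_mod p pr_p m K (dval_ring w) S1 SB SM l y (witt_map A b) Sy.
  have -> : y + witt_map A b = witt_pow (p ^ n) y by rewrite -Dy addrC subrK.
  rewrite wcoef_pow // wcoef_map opprD addrA; apply=> i lt_il.
  by rewrite wcoef_map; apply/SA/Obl.
have Sy i : (i < j)%N -> dval_ring w (wcoef y i).
  elim/ltn_ind: i => i IHi lt_ij; apply: (dval_ring_closed dw q1).
  rewrite -[_ - _](subrK (A (wcoef b i))); apply: (sringD S1 SB).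
    apply: Sstep => [|l lt_li|l lt_li].
    - exact: ltn_trans lt_jm.
    - by apply: IHi => //; apply: ltn_trans lt_ij.
    - by apply: Ob; apply: ltn_trans lt_ij.
  exact/SA/Ob.
apply: (no_unramified_pole pr_p n_gt0 irrD dw wD w_ge0 (y := wcoef y j) red).
have := sringD S1 SB (Sstep j lt_jm Sy Ob) (SA _ Oj).
by rewrite rmorphB /= addrA subrK.
Qed.

End UnramifiedWitt.

Section Normalization.
Variables (p n m r : nat) (pr_p : prime p) (n_gt0 : (0 < n)%N).
Variables (k0 : finFieldType) (char_p : p \in [pchar k0]).
Local Notation k := {fraction {poly k0}}.
Local Notation tf := (@FracField.tofrac {poly k0}).
Variable K : splittingFieldType k.
Variables (P : 'I_r -> {poly k0}) (P_inj : injective P).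
Hypothesis P_prime : forall i, P i \is monic /\ irreducible_poly (P i).
Hypothesis ramP : forall D : {poly k0}, D \is monic -> irreducible_poly D ->
  ramified K (prime_val D) -> exists i, P i = D.
Variable c : gal_of {:K} -> witt pr_p m K.
Local Notation G := 'Gal({:K} / 1)%g.
Local Notation A := (in_alg K).

Definition dvec D (e : 'I_m -> nat) (Q : 'I_m -> {poly k0}) : witt pr_p m k :=
  mk_witt pr_p (fun j => tf (Q j) / tf (D ^+ e j)).
Definition gvec (f : 'I_m -> {poly k0}) : witt pr_p m k :=
  mk_witt pr_p (fun j => tf (f j)).

(** The first j entries have reached their final form; the local parts and the
    polynomial part are kept zero from j on, so that the entry j can be
    filled in without disturbing the others. *)
Definition normalized_upto j (y : witt pr_p m K) e Q f (b : witt pr_p m k) :=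
  [/\ {in G, forall x, c x = witt_map x y - y},
      witt_pow (p ^ n) y - y = witt_map A b,
      wfil j (b - (\sum_(i < r) dvec (P i) (e i) (Q i) + gvec f)),
      (forall i (l : 'I_m), (j <= l)%N -> Q i l = 0)
        /\ (forall l : 'I_m, (j <= l)%N -> f l = 0)
    & (forall i l, pole_reduced p n (P i) (e i l) (Q i l))
        /\ (forall l, degree_reduced p n (f l))].

Let char_k : p \in [pchar k] := char_frack char_p.
Let char_K : p \in [pchar K].
Proof. exact: (rmorph_pchar A char_k). Qed.

Lemma wcoef_dvec D e Q (l : 'I_m) :
  wcoef (dvec D e Q) l = tf (Q l) / tf (D ^+ e l).
Proof. exact: wcoef_mk. Qed.

Lemma monic_irred_eq (D E : {poly k0}) : D \is monic -> E \is monic ->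
  irreducible_poly D -> irreducible_poly E -> D %| E -> D = E.
Proof.
move=> mD mE irrD irrE DE; apply/eqP; rewrite -eqp_monic //.
by apply: irrE.2 => //; rewrite (gtn_eqF irrD.1).
Qed.

Lemma local_ring_dvec D e Q i : D \is monic -> irreducible_poly D ->
  (forall i, P i != D) -> forall l, local_ring D (wcoef (dvec (P i) e Q) l).
Proof.
move=> mD irrD nPD l; have [lt_lm|le_ml] := ltnP l m; last first.
  by rewrite wcoef_ge // -(rmorph0 tf); apply: local_ring_poly.
rewrite (wcoef_dvec _ _ _ (Ordinal lt_lm)); apply: local_ring_frac.
have [mP irrP] := P_prime i; apply/negP => /(irred_dvdpX irrD) DP.
by have /eqP := nPD i; apply; rewrite (monic_irred_eq mD mP irrD irrP DP).
Qed.

Lemma local_ring_gvec D f : irreducible_poly D ->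
  forall l, local_ring D (wcoef (gvec f) l).
Proof.
move=> irrD l; have [lt_lm|le_ml] := ltnP l m; last first.
  by rewrite wcoef_ge // -(rmorph0 tf); apply: local_ring_poly.
by rewrite (wcoef_mk _ _ (Ordinal lt_lm)); apply: local_ring_poly.
Qed.

(** The entry j of the remainder is brought to the form given by
    [partial_fractions] by adding to y a vector supported in position j.  The
    entry j of the new b is then integral at a prime D outside the P_i, up to
    the D-part of this form; so that part is zero. *)
Lemma normalize_step j : (j < m)%N ->
  (exists y e Q f b, normalized_upto j y e Q f b) ->
  exists y e Q f b, normalized_upto j.+1 y e Q f b.
Proof.
move=> lt_jm [y [e [Q [f [b [cy Dy fb [Q0 f0] [redQ redf]]]]]]].
set N := \sum_(i < r) _ + _ in fb; set R := b - N in fb.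
pose x := wcoef R j.
have [a0 [s [eD [QD [g0 [us sP redD QD0 Ea0]]]]]] :=
  partial_fractions n_gt0 char_p (numer x) (denom_ratioP (generic_quotient.repr x)).
have Dx : tf (numer x) / tf (denom x) = x.
  have d0 : tf (denom x) != 0.
    by rewrite tofrac_eq0; apply: denom_ratioP.
  by rewrite /numer -tofrac_denom_mul mulrC mulKf.
have [a1 [g [Eg redg]]] := normalize_degree n_gt0 char_p g0.
(* First the poles of x are normalized, then the polynomial part left. *)
pose a := a0 + tf a1.
have Ea : x + artin_schreier p n a = \sum_(D <- s) tf (QD D) / tf (D ^+ eD D) + tf g.
  have -> : tf g = tf g0 + artin_schreier p n (tf a1).
    by rewrite -Eg rmorphD /artin_schreier rmorphB rmorphXn.
  by rewrite [RHS]addrA -Ea0 -/(denom x) Dx (artin_schreierD n char_k) [LHS]addrA.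
pose sj (z : k) : witt pr_p m k := wsingle pr_p m j z.
pose y' := y + witt_map A (sj a).
pose b' := b + (sj (a ^+ (p ^ n)) - sj a).
have fs z : wfil j (sj z) by apply: wfil_single.
have cs z : wcoef (sj z) j = z by rewrite wcoef_single // eqxx.
have cy' : {in G, forall u, c u = witt_map u y' - y'}.
  move=> u Gu; rewrite /y' [witt_map u (_ + _)]raddfD /= witt_map_comp.
  have -> : witt_map (u \o A) (sj a) = witt_map A (sj a).
    by apply: eq_witt_map => z /=; rewrite linearZ /= rmorph1.
  rewrite cy //; move: (witt_map u y) (witt_map A _) => t t'; by ring.
have Dy' : witt_pow (p ^ n) y' - y' = witt_map A b'.
  have -> : witt_map A b' = witt_pow (p ^ n) y - y
      + (witt_map A (sj (a ^+ (p ^ n))) - witt_map A (sj a)).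
    by rewrite /b' Dy -raddfB -raddfD.
  rewrite /y' witt_powD //.
  have -> : witt_pow (p ^ n) (witt_map A (sj a)) = witt_map A (sj (a ^+ (p ^ n))).
    apply: wcoefP => i lt_im; rewrite wcoef_pow // !wcoef_map -rmorphXn.
    rewrite !wcoef_single //; case: ifP => // _; rewrite expr0n expn_eq0.
    by rewrite (gtn_eqF (prime_gt0 pr_p)).
  move: (witt_pow _ _) (witt_map A (sj a)) (witt_map A _) => t t' t''; by ring.
pose R' := R + (sj (a ^+ (p ^ n)) - sj a).
have Db' : b' = N + R'.
  by rewrite /b' /R' /R; move: (sj _) (sj _) => t t'; ring.
have fss : wfil j (sj (a ^+ (p ^ n)) - sj a) by apply: wfilB.
have fR' : wfil j R' by apply: wfilD.
have cR' : wcoef R' j = \sum_(D <- s) tf (QD D) / tf (D ^+ eD D) + tf g.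
  by rewrite (wcoefD_lead fb fss) (wcoefB_lead (fs _) (fs _)) !cs -Ea.
have unram D : D \in s -> (forall i, P i != D) -> QD D = 0.
  move=> sD nPD; have [mD irrD _] := sP D sD.
  have nram : ~ ramified K (prime_val D).
    by move/(ramP mD irrD) => [i /eqP]; apply/negP.
  have O1 := local_ring1 irrD; have OB := local_ringB irrD.
  have OM := local_ringM irrD.
  have ON : forall l, local_ring D (wcoef N l).
    apply: (woverD O1 OB OM); last exact: local_ring_gvec.
    by apply: (wover_sum O1 OB OM) => i; apply: local_ring_dvec.
  have noP := no_unramified_witt_pole n_gt0 irrD nram lt_jm Dy'.
  apply: noP (redD D).
    move=> i lt_ij; rewrite Db' (wcoefD_fil _ fR') ?(ltnW lt_ij) // fR' //.
    by rewrite addr0.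
  rewrite Db' (wcoefD_fil _ fR') // cR' (perm_big _ (perm_to_rem sD)) /=.
  rewrite big_cons; set X := \sum_(_ <- _) _.
  have OX : local_ring D X.
    rewrite /X big_seq; apply: big_ind => [||E]; first exact: sring0 O1 OB.
      exact: sringD O1 OB.
    rewrite mem_rem_uniq // inE => /andP[nED /sP[mE irrE _]].
    apply: local_ring_frac; apply: contraNN nED => /(irred_dvdpX irrD) DE.
    by rewrite (monic_irred_eq mD mE irrD irrE DE).
  have -> : wcoef N j + (tf (QD D) / tf (D ^+ eD D) + X + tf g)
      - tf (QD D) / tf (D ^+ eD D) = wcoef N j + (X + tf g).
    by move: (tf (QD D) / _) => t; ring.
  apply: (sringD O1 OB) => //; apply: (sringD O1 OB) => //.
  exact: local_ring_poly.
pose jo := Ordinal lt_jm.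
pose Q' i l := if l == jo then QD (P i) else Q i l.
pose e' i l := if l == jo then eD (P i) else e i l.
pose f' l := if l == jo then g else f l.
exists y', e', Q', f', b'; split=> //.
- have dE i : dvec (P i) (e' i) (Q' i) = dvec (P i) (e i) (Q i)
      + sj (tf (QD (P i)) / tf (P i ^+ eD (P i))).
    apply: wcoefP => l lt_lm; rewrite wcoefD_single //; last first.
      move=> l' le_jl; have [lt'|le'] := ltnP l' m; last by rewrite wcoef_ge.
      by rewrite (wcoef_dvec _ _ _ (Ordinal lt')) Q0 // rmorph0 mul0r.
    rewrite !(wcoef_dvec _ _ _ (Ordinal lt_lm)) /Q' /e' -val_eqE /=.
    by case: ifP.
  have gE : gvec f' = gvec f + sj (tf g).
    apply: wcoefP => l lt_lm; rewrite wcoefD_single //; last first.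
      move=> l' le_jl; have [lt'|le'] := ltnP l' m; last by rewrite wcoef_ge.
      by rewrite (wcoef_mk _ _ (Ordinal lt')) f0 // rmorph0.
    rewrite !(wcoef_mk _ _ (Ordinal lt_lm)) /f' -val_eqE /=.
    by case: ifP.
  rewrite gE (eq_bigr _ (fun i _ => dE i)) big_split /= addrACA -/N.
  set T := \sum_(i < r) _ + _; rewrite Db' opprD addrACA subrr add0r.
  have fT : wfil j T by apply: wfilD; [apply: wfil_sum => i|]; apply: fs.
  apply: wfilS; first exact: wfilB.
  have fS : wfil j (\sum_(i < r) sj (tf (QD (P i)) / tf (P i ^+ eD (P i)))).
    by apply: wfil_sum => i; apply: fs.
  rewrite (wcoefB_lead fR' fT) cR' (wcoefD_lead fS (fs _)) wcoef_sum_lead //.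
  rewrite cs (eq_bigr (fun i => tf (QD (P i)) / tf (P i ^+ eD (P i)))) //.
  apply/eqP; rewrite subr_eq0; apply/eqP; congr (_ + _).
  have -> : \sum_(i < r) tf (QD (P i)) / tf (P i ^+ eD (P i)) =
      \sum_(D <- codom P) tf (QD D) / tf (D ^+ eD D).
    by rewrite big_map big_enum.
  apply: eq_sum_uniq => // [|D sD nPD|D _ /QD0->].
  - by rewrite map_inj_uniq ?enum_uniq.
  - rewrite unram ?rmorph0 ?mul0r // => i; apply: contraNneq nPD => <-.
    exact: codom_f.
  - by rewrite rmorph0 mul0r.
- split=> [i l|l] lt_jl; rewrite /Q' /f'.
    by case: eqVneq lt_jl => [->|_ /ltnW/Q0->//]; rewrite ltnn.
  by case: eqVneq lt_jl => [->|_ /ltnW/f0->//]; rewrite ltnn.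
- split=> [i l|l]; first by rewrite /e' /Q'; case: ifP => _.
  by rewrite /f'; case: ifP.
Qed.

End Normalization.

(** * Generation, irreducibility and the theorem *)

Section GaloisOverBase.
Variables (F : fieldType) (K : splittingFieldType F).
Hypothesis galK : galois 1 {:K}.
Local Notation G := 'Gal({:K} / 1)%g.

Lemma gal_base (u : gal_of {:K}) (a : F) : u a%:A = a%:A.
Proof. by rewrite linearZ /= rmorph1. Qed.

Lemma gal_fixed_base z :
  {in G, forall u : gal_of {:K}, u z = z} -> exists a : F, z = a%:A.
Proof.
move=> fz; have: z \in fixedField G.
  by apply/fixedFieldP => [|u Gu]; [apply: memvf | apply: fz].
by rewrite (galois_fixedField galK) => /vlineP[a ->]; exists a.
Qed.

(** By the Galois correspondence, a subfield fixed by the identity alone is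
    everything. *)
Lemma generated_by_moved (s : seq K) :
    {in G, forall u : gal_of {:K}, {in s, forall z, u z = z} -> u = 1%g} ->
  <<1 & s>>%VS = {:K}%VS.
Proof.
move=> moved; pose E := <<1 & s>>%AS.
have galE : galois E {:K} by apply: galoisS galK; rewrite sub1v subvf.
have trivE : 'Gal({:K} / E)%g = 1%g.
  apply/trivgP/subsetP => u Eu; have Gu : u \in G.
    by apply: subsetP Eu; apply: galS; apply: sub1v.
  rewrite inE; apply/eqP/(moved _ Gu) => z sz.
  apply: (fixed_gal _ Eu); first exact: subvf.
  exact: seqv_sub_adjoin.
rewrite -[LHS]/(E : {vspace K}) -(galois_fixedField galE) trivE.
apply/eqP; rewrite eqEsubv subvf; apply/subvP => z _.
apply/fixedFieldP => [|u]; first exact: memvf.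
by rewrite inE => /eqP->; rewrite gal_id.
Qed.

(** The roots of X^q - X - b are the elements of R, and they are conjugate; so
    a divisor over the base field that has one of them as a root has them
    all. *)
Lemma artin_schreier_irreducible q (y : K) (b : F) (R : seq K) :
    (1 < q)%N -> y ^+ q - y = b%:A -> uniq R -> size R = q ->
    {in R, forall z, exists2 u : gal_of {:K}, u \in G & z = u y} ->
  irreducible_poly ('X^q - 'X - b%:P).
Proof.
move=> q1 Dy uR szR conjR; set f := 'X^q - 'X - b%:P.
have szf : size f = q.+1.
  rewrite /f -addrA size_polyDl ?size_polyXn // -opprD size_polyN.
  apply: leq_ltn_trans (size_polyD _ _) _; rewrite size_polyX gtn_max ltnS q1.
  by rewrite ltnS (leq_trans (size_polyC_leq1 _)) // ltnW.
have f0 : f != 0 by rewrite -size_poly_gt0 szf.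
pose toK := map_poly (in_alg K).
have Df : toK f = \prod_(z <- R) ('X - z%:P).
  have lf : lead_coef (toK f) = 1.
    rewrite lead_coef_map lead_coefE szf /= /f !coefB coefXn eqxx coefX coefC.
    by rewrite (gtn_eqF q1) (gtn_eqF (ltnW q1)) !subr0 scale1r.
  rewrite [LHS](@all_roots_prod_XsubC _ _ R); rewrite ?lf ?scale1r //.
  - by rewrite size_map_poly szf szR.
  - apply/allP => z /conjR[u Gu ->]; rewrite /root /toK /f.
    rewrite !rmorphB /= map_polyXn map_polyX map_polyC !hornerE /=.
    rewrite -rmorphXn -rmorphB /= Dy gal_base; apply/eqP; apply: subrr.
  - by rewrite uniq_rootsE.
split=> [|d d1 df]; first by rewrite szf ltnS ltnW.
have [z Rz dz] : exists2 z, z \in R & root (toK d) z.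
  have : toK d %| \prod_(z <- R) ('X - z%:P) by rewrite -Df dvdp_map.
  case/dvdp_prod_XsubC => mk /[dup] Dd /eqp_size.
  rewrite size_map_poly; case Em: (mask mk R) => [|z s] szd.
    by move: d1; rewrite szd big_nil size_poly1.
  exists z; first by apply: (mem_mask (m := mk)); rewrite Em inE eqxx.
  by rewrite (eqp_root Dd) Em root_prod_XsubC inE eqxx.
have d0 : d != 0 by apply: dvdpN0 df f0.
have all_d : all (root (toK d)) R.
  (* the automorphism u^-1 u' maps the root z = u y of d to u' y *)
  have [u Gu Dz] := conjR z Rz; apply/allP => z' /conjR[u' Gu' ->].
  have -> : u' y = (u^-1 * u')%g z.
    by rewrite gal_mulE Dz; congr (u' _); rewrite -gal_mulE mulgV gal_id.
  have -> : toK d = map_poly (u^-1 * u')%g (toK d).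
    by rewrite -map_poly_comp; apply: eq_map_poly => a /=; rewrite gal_base.
  by rewrite fmorph_root.
rewrite -dvdp_size_eqp // eqn_leq dvdp_leq //= szf -szR.
rewrite -(size_map_poly (in_alg K) d); apply: max_poly_roots => //.
by rewrite map_poly_eq0.
Qed.

End GaloisOverBase.

Theorem theorem8p10 (p n m r : nat) (pr_p : prime p) (m_gt0 : (0 < m)%N)
  (k0 : finFieldType) (char_k0 : p \in [pchar k0])
  (Fq : finFieldType) (card_Fq : #|Fq| = (p ^ n)%N)
  (iota : {rmorphism Fq -> k0})
  (K : splittingFieldType {fraction {poly k0}})
  (galK : galois 1 {:K})
  (isoK : 'Gal({:K} / 1) \isog [set: witt pr_p m Fq])
  (P : 'I_r -> {poly k0}) (P_inj : injective P)
  (P_prime : forall i, P i \is monic /\ irreducible_poly (P i))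
  (ramP : forall D : {poly k0}, D \is monic -> irreducible_poly D ->
    (ramified K (prime_val D) <-> exists i, P i = D)) :
  exists (y : witt pr_p m K) (e : 'I_r -> 'I_m -> nat)
         (Q : 'I_r -> 'I_m -> {poly k0}) (f : 'I_m -> {poly k0}),
    let q := (p ^ n)%N in
    let delta (i : 'I_r) : witt pr_p m {fraction {poly k0}} :=
      mk_witt pr_p (fun j => tofrac (Q i j) / tofrac (P i ^+ e i j)) in
    let gamma : witt pr_p m {fraction {poly k0}} :=
      mk_witt pr_p (fun j => tofrac (f j)) in
    let beta := \sum_(i < r) delta i + gamma in
    let y1 := witt_coord y (Ordinal m_gt0) in
    let beta1 := witt_coord beta (Ordinal m_gt0) in
    [/\ <<1 & witt_seq y>>%VS = {:K}%VS
          /\ witt_pow q y - y = witt_map (in_alg K) beta,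
        y1 ^+ q - y1 = beta1%:A,
        irreducible_poly ('X^q - 'X - beta1%:P),
        forall i j, (0 < e i j)%N ->
          [/\ exists lambda mu : nat,
                [/\ e i j = (lambda * p ^ mu)%N, coprime lambda p & (mu < n)%N],
              coprimep (Q i j) (P i)
            & (size (Q i j) < size (P i ^+ e i j))%N]
      & forall j, (1 < size (f j))%N ->
          exists nu mu : nat,
            [/\ (size (f j)).-1 = (nu * p ^ mu)%N, coprime q nu
              & (mu < n)%N]].
Proof.
set q := (p ^ n)%N.
have q1 : (1 < q)%N by rewrite /q -card_Fq finNzRing_gt1.
have n_gt0 : (0 < n)%N by case: n @q q1 {card_Fq} => //=; rewrite expn0.
have char_K : p \in [pchar K].
  exact: (rmorph_pchar (in_alg K) (char_frack char_k0)).
have [h hE] : exists h : {rmorphism Fq -> K},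
    forall a, h a = (tofrac (iota a)%:P)%:A.
  by exists (in_alg K \o @FracField.tofrac {poly k0} \o polyC \o iota).
have [f injf imf] := isogP isoK.
pose c (u : gal_of {:K}) : witt pr_p m K := witt_map h (f u).
have hq a : h a ^+ q = h a by rewrite -rmorphXn /q -card_Fq expf_card.
(* c takes values in W_m(k), where G acts trivially, so it is a cocycle. *)
have c_fix (u v : gal_of {:K}) : witt_map u (c v) = c v.
  rewrite /c witt_map_comp; apply: eq_witt_map => a /=.
  by rewrite hE gal_base.
have cM : {in 'Gal({:K} / 1)%g &, forall u v, c (u * v)%g = witt_map v (c u) + c v}.
  by move=> u v Gu Gv; rewrite c_fix /c morphM // -raddfD.
have c_inj : {in 'Gal({:K} / 1)%g, forall u, c u = 0 -> u = 1%g}.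
  move=> u Gu cu0; have fu0 : f u = 0.
    apply: wcoefP => i _; apply: (fmorph_inj h).
    have := congr1 (fun z => wcoef z i) cu0.
    by rewrite /c wcoef_map !wcoef0 rmorph0.
  by apply: (injmP injf) => //; rewrite morph1; apply: fu0.
have [y0 Dy0] := witt_Hilbert_90 cM.
(* F(y0) - y0 is G-invariant because both F and G fix the values of c. *)
have [b0 Db0] : exists b : witt pr_p m {fraction {poly k0}},
    witt_pow q y0 - y0 = witt_map (in_alg K) b.
  set z := witt_pow q y0 - y0.
  have fix_z i : exists a : {fraction {poly k0}}, wcoef z i = in_alg K a.
    apply: (gal_fixed_base galK) => u Gu.
    rewrite -(wcoef_map u); congr (wcoef _ i).
    have uy : witt_map u y0 = y0 + c u by rewrite Dy0 // addrC subrK.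
    have uFy : witt_map u (witt_pow q y0) = witt_pow q (witt_map u y0).
      apply: wcoefP => l lt_lm; rewrite wcoef_map !wcoef_pow // wcoef_map.
      exact: rmorphXn.
    rewrite /z raddfB /= uFy uy witt_powD //.
    have -> : witt_pow q (c u) = c u.
      apply: wcoefP => l lt_lm; rewrite wcoef_pow // !wcoef_map.
      exact: hq.
    by rewrite opprD addrACA subrr addr0.
  have [a Da] := boolp.choice fix_z.
  exists (mk_witt pr_p (fun i : 'I_m => a i)); apply: wcoefP => i lt_im.
  by rewrite wcoef_map (wcoef_mk _ _ (Ordinal lt_im)) Da.
have [y [e [Q [g [b [cy Dy fb _ [redQ redg]]]]]]] :
    exists y e Q g b, normalized_upto n P c m y e Q g b.
  have ramP' D mD irrD := (ramP D mD irrD).1.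
  have step j := normalize_step n_gt0 char_k0 P_inj P_prime ramP' (c := c) (j := j).
  suff: forall j, (j <= m)%N ->
      exists y e Q g b, normalized_upto n P c j y e Q g b by apply.
  elim=> [_|j IHj lt_jm]; last by apply: step => //; apply/IHj/ltnW.
  exists y0, (fun _ _ => 0%N), (fun _ _ => 0), (fun=> 0), b0; split=> //.
  split=> [i l|l]; last by rewrite /degree_reduced size_poly0.
  by split=> //; rewrite size_poly0 size_poly1.
have Db : b = \sum_(i < r) dvec pr_p (P i) (e i) (Q i) + gvec pr_p g.
  by apply/eqP; rewrite -subr_eq0; apply/eqP/wfil_full.
exists y, e, Q, g => q' delta gamma beta y1 beta1.
have {}Db : b = beta by [].
rewrite /y1 /beta1 !wcoef_coord /= /q' {q' y1 beta1}; rewrite {}Db in Dy fb.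
have Dy1 : wcoef y 0 ^+ q - wcoef y 0 = (wcoef beta 0)%:A.
  have := congr1 (fun z => wcoef z 0) Dy; rewrite wcoef_map /= => <-.
  rewrite wcoefD0 wcoef_pow //; congr (_ + _).
  by rewrite (wcoefN_lead (j := 0)).
split=> //.
- split=> //; apply: generated_by_moved galK _ _ => u Gu fixy.
  apply: c_inj => //; rewrite cy //; apply/eqP; rewrite subr_eq0; apply/eqP.
  apply: wcoefP => i lt_im; rewrite wcoef_map; apply: fixy.
  by apply: mem_nth; rewrite size_tuple.
- apply: (artin_schreier_irreducible (R := [seq wcoef y 0 + h a | a <- enum Fq]) q1 Dy1).
  + rewrite map_inj_uniq ?enum_uniq // => a a' /addrI; exact: fmorph_inj.
  + by rewrite size_map -cardE card_Fq.
  move=> _ /mapP[a _ ->].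
  have : wsingle pr_p m 0 a \in (f @* 'Gal({:K} / 1))%g by rewrite imf inE.
  case/morphimP=> u _ Gu Du; exists u => //.
  have := cy u Gu; rewrite /c -Du => /(congr1 (fun z => wcoef z 0)).
  rewrite wcoef_map wcoef_single //= wcoefD0 (wcoefN_lead (j := 0)) // wcoef_map.
  by move=> ->; rewrite addrC subrK.
- move=> i j e_gt0; have [lt_Q red] := redQ i j.
  by have [ex cop] := red e_gt0; split.
Qed.
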